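(* Let $X$ be a complex Banach space with open unit ball $\mathbb{B}$, let $\lambda,\mu\in\mathbb{C}$, $e\in\partial\mathbb{B}$ and $e^*\in J(e)$ be given. Let $f$ be an $X$-valued mapping holomorphic in a neighborhood of the origin of $X$ and represented there by the series of homogeneous polynomials $f(x)=x+\sum_{k=2}^\infty P_k(x)$. Then: (i) Let $n\in\mathbb{N}$. If $P_2(e)=\nu e$ for some $\nu\in\mathbb{C}$, and $g(x)=x+\sum_{k=2}^\infty Q_k(x)$ is an $n$-th root transform of $f$ (with respect to $e,e^*$), then $Q_{2n+1}(e)=\frac1n\,\Psi_e\left(f,\frac{n-1}{2n},\mu\right)$ for any $\mu\in\mathbb{C}$. In addition, if $f$ is of one-dimensional type, $f(x)=s(x)x$ with $s\in\mathrm{Hol}(\mathbb{B},\mathbb{C})$, and $f$ is univalent (injective) in $\mathbb{B}$, then its $n$-th root transform $g(x)=\left(s(\langle x,e^*\rangle^n e)\right)^{1/n}x$ is also of one-dimensional type and univalent in $\mathbb{B}$. (ii) If $X$ is a Hilbert space, $U$ is a unitary operator on $X$, and $g=U^*f\circ U$, then $\Psi_e(g,\lambda,\mu)=U^*\Psi_{\tilde e}(f,\lambda,\mu)$ with $\tilde e=Ue$. (iii) If $g(x)=x+\sum_{k=2}^\infty Q_k(x)$ is another mapping holomorphic in a neighborhood of the origin of $X$, and the second Fréchet derivative at the origin of either $f$ or $g$ is zero, then $\Psi_e(f\circ g,\lambda,\mu)=\Psi_e(f,\lambda,\mu)+\Psi_e(g,\lambda,\mu)$. (iv) If $f^{-1}$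 denotes the inverse mapping of $f$ (defined in a neighborhood of the origin), then $\Psi_e(f^{-1},\lambda,\mu)=-\Psi_e(f,2-\lambda,2-\mu)$. (v) If $n\in\mathbb{N}$ and $f^n$ denotes the $n$-th iterate of $f$ (defined in a neighborhood of the origin), then $\Psi_e(f^n,\lambda,\mu)=n\Psi_e(f,\lambda_n,\mu_n)$, where $\lambda_n=n\lambda-n+1$ and $\mu_n=n\mu-n+1$.
   Context: Notation: $L(X)$ is the space of bounded linear operators on $X$, $X^*$ the dual space with pairing $\langle x,a\rangle$ ($x\in X$, $a\in X^*$), $\mathrm{Id}$ the identity operator, and $J(x)=\{x^*\in X^*:\|x^*\|=\|x\|,\ \langle x,x^*\rangle=\|x\|^2\}$. If $X$ is a Hilbert space, $e^*\in J(e)$ is identified with $e$. $\mathrm{Hol}(\mathbb{B},Y)$ is the set of holomorphic (Fréchet differentiable) mappings $\mathbb{B}\to Y$. For $f$ holomorphic near $0$, $P_k(x)=\frac1{k!}D^kf(0)[x^k]$, where $D^kf(0)$ is the $k$-th Fréchet derivative at $0$, a bounded symmetric $k$-linear operator, and $[x^k]$ means $[x,\dots,x]$. Fekete–Szegő mapping: for a mapping $f(x)=x+\sum_{k\ge2}P_k(x)$ holomorphic near $0$, $\lambda,\mu\in\mathbb{C}$, $e\in\partial\mathbb{B}$ and a fixed $e^*\in J(e)$, $$\Psi_e(f,\lambda,\mu)=P_3(e)-\frac{\mu}{2}D^2f(0)[e,P_2(e)]-(\lambda-\mu)\langle P_2(e),e^*\rangle P_2(e).$$ A mapping is of one-dimensional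 type if it has the form $f(x)=s(x)x$ with $s$ a scalar-valued holomorphic function. $n$-th root transform: write $f(x)=\kappa(x)x$ where $\kappa$ is a holomorphic $L(X)$-valued mapping with $\kappa(0)=\mathrm{Id}$ (such $\kappa$ exists, in general not unique). Near the origin $\kappa^{1/n}$ is the holomorphic $L(X)$-valued power with $\kappa^{1/n}(0)=\mathrm{Id}$ (given near $0$ by the binomial series in $\kappa-\mathrm{Id}$). An $n$-th root transform of $f$ is $g(x)=\left(\kappa(\langle x,e^*\rangle^n e)\right)^{1/n}x$ for such a choice of $\kappa$. If $f(x)=s(x)x$ is of one-dimensional type, one takes $\kappa=s\,\mathrm{Id}$; if in addition $f$ is univalent in $\mathbb{B}$, $s^{1/n}$ denotes the holomorphic branch on $\mathbb{B}$ of the $n$-th root of the nonvanishing function $s$ with value $1$ at $0$. *)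

(* Defs.v *)
From HB Require Import structures.
From mathcomp Require Import all_boot all_order all_algebra complex.
From mathcomp Require Import all_classical all_reals all_analysis.
Set Implicit Arguments.
Unset Strict Implicit.
Unset Printing Implicit Defensive.
Import Order.TTheory GRing.Theory Num.Theory.
Import numFieldNormedType.Exports.
Local Open Scope classical_set_scope.
Local Open Scope complex_scope.
Local Open Scope ring_scope.

Section BoundedOperators.
Context (R : realType) (X Y : normedModType R[i]).

Definition blin_pred : {pred X -> Y} :=
  [pred f | `[< linear f /\ continuous f >]].

Record blin := Blin { blin_fun :> X -> Y; blinP : blin_fun \in blin_pred }.

HB.instance Definition _ := [isSub for blin_fun].
HB.instance Definition _ := [Choice of blin by <:].

Lemma blin_submod : submod_closed blin_pred.
Proof.
split; rewrite ?inE; first split.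
- by move=> a x y; rewrite /= scaler0 addr0.
- exact: cst_continuous.
move=> a f g; rewrite !inE => -[lf cf] [lg cg]; split.
  move=> b x y; rewrite /= !fctE lf lg !scalerDr !scalerA (mulrC a b).
  by rewrite addrACA.
move=> x; apply: cvgD; last exact: cg.
by apply: cvgZl_tmp; exact: cf.
Qed.

HB.instance Definition _ := GRing.isSubmodClosed.Build _ _ blin_pred blin_submod.
HB.instance Definition _ := [SubChoice_isSubLmodule of blin by <:].

Lemma blin_linear (T : blin) : linear T.
Proof. by have := blinP T; rewrite inE => -[]. Qed.

HB.instance Definition _ (T : blin) :=
  GRing.isLinear.Build _ _ _ _ (blin_fun T) (blin_linear T).

Lemma blin_continuous (T : blin) : continuous T.
Proof. by have := blinP T; rewrite inE => -[]. Qed.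

(* [sup] lives in [R] whereas norms over [R[i]] are real elements of [R[i]]. *)
Definition blin_norm (T : blin) : R[i] :=
  (sup [set complex.Re `|T x| | x in [set x : X | `|x| <= 1]])%:C.

Let normE (Z : normedModType R[i]) (z : Z) : `|z| = (complex.Re `|z|)%:C.
Proof. by rewrite RRe_real// ger0_real. Qed.

Let has_ub (T : blin) :
  has_ubound [set complex.Re `|T x| | x in [set x : X | `|x| <= 1]].
Proof.
have /linear_boundedP/pinfty_ex_gt0[M M0 HM] :=
  (linear_bounded_continuous T).2 (@blin_continuous T).
exists (complex.Re M) => _ [x /= x1 <-].
have := le_trans (HM x) (ler_piMr (ltW M0) x1).
by rewrite lecE => /andP[].
Qed.

Let nonempty (T : blin) :
  [set complex.Re `|T x| | x in [set x : X | `|x| <= 1]] !=set0.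
Proof. by exists (complex.Re `|T 0|), 0; rewrite //= normr0. Qed.

Lemma blin_norm_ub (T : blin) (x : X) : `|x| <= 1 -> `|T x| <= blin_norm T.
Proof.
move=> x1; rewrite normE lecR; apply: ub_le_sup; first exact: has_ub.
by exists x.
Qed.

Lemma blin_norm_le (T : blin) (M : R[i]) :
  (forall x, `|x| <= 1 -> `|T x| <= M) -> blin_norm T <= M.
Proof.
move=> TM; have M0 : 0 <= M.
  by apply: le_trans (TM 0 _); rewrite ?normr_ge0// normr0.
rewrite -[M]RRe_real ?ger0_real// lecR; apply: ge_sup => //.
by move=> _ [x /= x1 <-]; have := TM x x1; rewrite lecE => /andP[].
Qed.

Lemma blin_normP (T : blin) (x : X) : `|T x| <= blin_norm T * `|x|.
Proof.
have [->|x0] := eqVneq x 0; first by rewrite linear0 !normr0 mulr0.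
have nx0 : 0 < `|x| by rewrite normr_gt0.
rewrite -ler_pdivrMr// mulrC.
have -> : `|x|^-1 * `|T x| = `|T (`|x|^-1 *: x)|.
  by rewrite linearZ/= normrZ ger0_norm// invr_ge0.
apply: blin_norm_ub; rewrite normrZ ger0_norm ?invr_ge0//.
by rewrite mulVf// gt_eqF.
Qed.

Lemma blin_normD (S T : blin) :
  blin_norm (S + T) <= blin_norm S + blin_norm T.
Proof.
apply: blin_norm_le => x x1.
have -> : (S + T) x = S x + T x by [].
by rewrite (le_trans (ler_normD _ _))// lerD// blin_norm_ub.
Qed.

Let blin_normZ_le (a : R[i]) (T : blin) :
  blin_norm (a *: T) <= `|a| * blin_norm T.
Proof.
apply: blin_norm_le => x x1.
have -> : (a *: T) x = a *: T x by [].
by rewrite normrZ ler_wpM2l// blin_norm_ub.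
Qed.

Lemma blin_normZ (a : R[i]) (T : blin) :
  blin_norm (a *: T) = `|a| * blin_norm T.
Proof.
apply/eqP; rewrite eq_le blin_normZ_le/=.
have [->|a0] := eqVneq a 0.
  rewrite normr0 mul0r; apply: le_trans (blin_norm_ub _ (_ : `|0| <= 1)) => //.
  by rewrite normr0.
rewrite -ler_pdivlMl ?normr_gt0// -normfV.
by have := blin_normZ_le a^-1 (a *: T); rewrite scalerA mulVf// scale1r.
Qed.

Lemma blin_norm0_eq0 (T : blin) : blin_norm T = 0 -> T = 0.
Proof.
move=> T0; apply: val_inj; apply/funext => x; apply/eqP.
by rewrite -normr_le0; have := blin_normP T x; rewrite T0 mul0r.
Qed.

HB.instance Definition _ :=
  Lmodule_isNormed.Build R[i] blin blin_normD blin_normZ blin_norm0_eq0.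

End BoundedOperators.

Arguments Blin {R X Y}.

Section Operators.
Context (R : realType) (X : normedModType R[i]).

Lemma idfun_blin : (idfun : X -> X) \in @blin_pred R X X.
Proof. by rewrite inE; split => [a x y //|x]; exact: cvg_id. Qed.

Definition blin_id : blin X X := Blin idfun idfun_blin.

Lemma comp_blin (S T : blin X X) : (S \o T) \in @blin_pred R X X.
Proof.
rewrite inE; split; first by move=> a x y /=; rewrite !linearP.
by move=> x; apply: continuous_comp; exact: blin_continuous.
Qed.

Definition blin_comp (S T : blin X X) : blin X X := Blin (S \o T) (comp_blin S T).

Definition blin_exp (T : blin X X) (k : nat) : blin X X :=
  iter k (blin_comp T) blin_id.

Definition gbinom (a : R[i]) (k : nat) : R[i] :=
  (\prod_(i < k) (a - i%:R)) / k`!%:R.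

(* The branch of T^a equal to Id at T = Id; meaningful for T near Id, where the
   binomial series converges. *)
Definition blin_pow (T : blin X X) (a : R[i]) : blin X X :=
  lim (series (fun k => gbinom a k *: blin_exp (T - blin_id) k) @ \oo).

End Operators.

Section Frechet.
Context (R : realType) (X : normedModType R[i]).

Lemma diff_blin (Y : normedModType R[i]) (f : X -> Y) (x : X) :
  differentiable f x -> ('d f x : X -> Y) \in @blin_pred R X Y.
Proof. by move=> fx; rewrite inE; split; [exact: linearP|exact: diff_continuous]. Qed.

Definition frechet (Y : normedModType R[i]) (f : X -> Y) (x : X) : blin X Y :=
  if pselect (differentiable f x) is left fx then Blin ('d f x) (diff_blin fx)
  else 0.

(* [mlin Y k] is L(X, L(X, ... L(X, Y))), i.e. the bounded k-linear operators
   from X^k to Y in curried form. *)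
Fixpoint mlin (Y : normedModType R[i]) (k : nat) : normedModType R[i] :=
  if k is k'.+1 then blin X (mlin Y k') else Y.

Fixpoint Dn (Y : normedModType R[i]) (f : X -> Y) (k : nat) : X -> mlin Y k :=
  if k is k'.+1 then frechet (Dn f k') else f.

Fixpoint mdiag (Y : normedModType R[i]) (k : nat) : mlin Y k -> X -> Y :=
  if k is k'.+1 then fun A x => mdiag (A x : mlin Y k') x else fun y _ => y.

End Frechet.

Notation dual X := (blin X (complex _)^o).

Section FeketeSzego.
Context (R : realType) (X : normedModType R[i]).
Local Notation C := R[i].

Definition unit_ball : set X := [set x | `|x| < 1].

Definition holomorphic_on (Y : normedModType C) (D : set X) (f : X -> Y) :=
  forall x, D x -> differentiable f x.

Definition holomorphic_near0 (Y : normedModType C) (f : X -> Y) :=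
  \forall x \near (0 : X), differentiable f x.

Definition homog (f : X -> X) (k : nat) (x : X) : X :=
  (k`!%:R : C)^-1 *: mdiag (Dn f k 0) x.

Definition normalized_holomorphic (f : X -> X) :=
  holomorphic_near0 f /\
  \forall x \near (0 : X),
    (fun N => x + \sum_(2 <= k < N) homog f k x) @ \oo --> f x.

(* This is J(x), as a subset of X^*. *)
Definition duality_map (x : X) : set (dual X) :=
  [set xs : dual X | `|xs| = `|x| /\ xs x = `|x| ^+ 2].

Definition D2at0 (f : X -> X) : blin X (blin X X) := Dn f 2 0.

Definition Psi (e : X) (es : dual X) (f : X -> X) (lam mu : C) : X :=
  homog f 3 e - (mu / 2) *: D2at0 f e (homog f 2 e)
  - ((lam - mu) * es (homog f 2 e)) *: homog f 2 e.

Definition one_dim_type (f : X -> X) :=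
  exists2 s : X -> C^o, holomorphic_on unit_ball s
    & forall x, unit_ball x -> f x = s x *: x.

Definition univalent (f : X -> X) :=
  holomorphic_on unit_ball f /\ {in unit_ball &, injective f}.

Definition root_transform (n : nat) (e : X) (es : dual X) (f g : X -> X) :=
  exists kappa : X -> blin X X,
    [/\ holomorphic_near0 kappa, kappa 0 = blin_id X,
        \forall x \near (0 : X), f x = kappa x x &
        \forall x \near (0 : X),
          g x = blin_pow (kappa ((es x : C) ^+ n *: e)) n%:R^-1 x].

Definition root_branch (n : nat) (s r : X -> C^o) :=
  [/\ holomorphic_on unit_ball r, r 0 = 1 &
      forall x, unit_ball x -> (r x : C) ^+ n = s x].

(* f : X -> X stands for its germ at 0, and so does its inverse h; continuity at
   0 discards set-theoretic inverses whose values near 0 are far from 0. *)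
Definition local_inverse (f h : X -> X) :=
  [/\ h 0 = 0, {for 0, continuous h},
      \forall x \near (0 : X), h (f x) = x &
      \forall y \near (0 : X), f (h y) = y].

Definition hilbert_dot (dot : {dot X for Num.conj}) :=
  forall x : X, `|x| ^+ 2 = dot x x.

Definition unitary (dot : {dot X for Num.conj}) (U Us : blin X X) :=
  [/\ forall x y, dot (U x) y = dot x (Us y),
      blin_comp Us U = blin_id X & blin_comp U Us = blin_id X].

End FeketeSzego.

Arguments unit_ball {R} X.

(* Main.v *)
(* A normalized f is the pointwise sum of its Taylor terms P_k. Averaging over
   roots of unity gives Cauchy's inequality for power series without contour
   integrals, hence geometric bounds on the P_k near 0. The same averages express
   the derivative of a polynomial through its values, so the bounds survive
   termwise differentiation: f is smooth near 0 and D^2 f(0), a limit of symmetric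
   forms, is symmetric. The chain rule at 0 for tangent-to-identity germs reads
     D^2(f o g) = D^2 f + D^2 g,
     D^3(f o g)[e,e,e] = D^3 f[e,e,e] + D^3 g[e,e,e] + 3 D^2 f[e, D^2 g[e,e]],
   and (iii), (iv), (v) follow by substitution. For (i), compare the expansions of
   t |-> g (t e) on both sides. *)
Require Import Defs.
From HB Require Import structures.
From mathcomp Require Import all_boot all_order all_algebra complex.
From mathcomp Require Import cyclic separable cyclotomic.
From mathcomp Require Import all_classical all_reals all_analysis.
From mathcomp Require Import zify ring lra.
Set Implicit Arguments.
Unset Strict Implicit.
Unset Printing Implicit Defensive.
Import Order.TTheory GRing.Theory Num.Theory.
Import numFieldNormedType.Exports.
Local Open Scope classical_set_scope.
Local Open Scope complex_scope.
Local Open Scope ring_scope.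

(** * Real-valued norm and Frechet derivatives *)

(** Only first-order differentiability of [f] near 0 and pointwise convergence of its Taylor
    polynomials are assumed, while [Psi] involves three nested applications of [frechet], which
    returns 0 wherever differentiability fails. So the higher derivatives must be shown to exist
    near 0 before anything can be computed. They live in the nested operator spaces [mlin]; the only
    completeness used there is convergence of series dominated by [M * 2^-k], which operator spaces
    inherit from their codomain. The factor [2^-k] is bought by homogeneity, at the price of a
    smaller radius. Iterates and inverses are treated as tangent germs, three times differentiable
    near 0, so their own Taylor series never have to be summed. The inverse in (iv) is given merely
    as continuous at 0: a lower bound for increments of [f] makes it Lipschitz, and its regularity
    then bootstraps through operator inversion. In (ii), [es] and [ets] are arbitrary elements of
    the duality sets, so the Hilbert norm must first identify them with inner products. *)

Section RealNorm.
Context (R : realType).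
Implicit Types (Z : normedModType R[i]).

(* Over [R[i]] norms take values in [R[i]], whose order is only partial. *)
Definition nrm Z (z : Z) : R := complex.Re `|z|.

Lemma nrmE Z (z : Z) : `|z| = (nrm z)%:C.
Proof. by rewrite RRe_real// ger0_real. Qed.

Lemma nrm_ge0 Z (z : Z) : 0 <= nrm z.
Proof. by rewrite -ler0c -nrmE. Qed.

Lemma nrm0 Z : nrm (0 : Z) = 0.
Proof. by apply: complexI; rewrite -nrmE normr0. Qed.

Lemma nrm0P Z (z : Z) : nrm z <= 0 -> z = 0.
Proof. by rewrite -lecR -nrmE normr_le0 => /eqP. Qed.

Lemma nrm_gt0 Z (z : Z) : z != 0 -> 0 < nrm z.
Proof.
move=> z0; rewrite lt_neqAle nrm_ge0 andbT eq_sym.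
by apply: contra z0 => /eqP z0; apply/eqP/nrm0P; rewrite z0.
Qed.

Lemma nrmD Z (x y : Z) : nrm (x + y) <= nrm x + nrm y.
Proof. by rewrite -lecR rmorphD/= -!nrmE ler_normD. Qed.

Lemma nrmN Z (x : Z) : nrm (- x) = nrm x.
Proof. by rewrite /nrm normrN. Qed.

Lemma nrmB Z (x y : Z) : nrm (x - y) <= nrm x + nrm y.
Proof. by rewrite -(nrmN y) nrmD. Qed.

Lemma nrmBC Z (x y : Z) : nrm (x - y) = nrm (y - x).
Proof. by rewrite -nrmN opprB. Qed.

Lemma nrm_sum Z (I : Type) (r : seq I) (P : pred I) (F : I -> Z) :
  nrm (\sum_(i <- r | P i) F i) <= \sum_(i <- r | P i) nrm (F i).
Proof.
elim/big_ind2 : _ => //; first by rewrite nrm0.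
by move=> a b c d ab cd; rewrite (le_trans (nrmD _ _))// lerD.
Qed.

Lemma nrmZ Z (a : R[i]) (z : Z) : nrm (a *: z) = nrm (a : R[i]^o) * nrm z.
Proof. by apply: complexI; rewrite -nrmE normrZ !nrmE rmorphM. Qed.

Lemma nrmCM (a b : R[i]) :
  nrm (a * b : R[i]^o) = nrm (a : R[i]^o) * nrm (b : R[i]^o).
Proof. exact: (nrmZ a (b : R[i]^o)). Qed.

Lemma nrmC1 : nrm (1 : R[i]^o) = 1.
Proof. by apply: complexI; rewrite -nrmE normr1. Qed.

Lemma nrmCX (a : R[i]) n : nrm (a ^+ n : R[i]^o) = nrm (a : R[i]^o) ^+ n.
Proof. by elim: n => [|n IH]; rewrite ?expr0 ?nrmC1// !exprS nrmCM IH. Qed.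

Lemma nrmC_real (a : R) : nrm (a%:C : R[i]^o) = `|a|.
Proof.
rewrite /nrm.
have [a0|a0] := leP 0 a; first by rewrite !ger0_norm// ler0c.
by rewrite !ltr0_norm// -?oppr_gt0 -?(rmorphN (real_complex R)) ?ltcR ?oppr_gt0.
Qed.

Lemma nrmZr Z (a : R) (z : Z) : 0 <= a -> nrm (a%:C *: z) = a * nrm z.
Proof. by move=> a0; rewrite nrmZ nrmC_real ger0_norm. Qed.

Lemma nrmC_nat n : nrm (n%:R : R[i]^o) = n%:R.
Proof.
by rewrite -(rmorph_nat (real_complex R)) nrmC_real ger0_norm.
Qed.

Lemma nrmCV (a : R[i]) : nrm (a^-1 : R[i]^o) = (nrm (a : R[i]^o))^-1.
Proof. by apply: complexI; rewrite fmorphV -!nrmE normfV. Qed.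

Lemma nbhs_nrmP Z (z : Z) (P : set Z) :
  nbhs z P <-> exists2 d : R, 0 < d & forall y, nrm (y - z) < d -> P y.
Proof.
split=> [/nbhs_normP[d /= d0 dP]|[d d0 dP]].
  exists (complex.Re d).
    by move: d0; rewrite ltcE => /andP[].
  move=> y yd; apply: dP => /=.
  have dE : d = (complex.Re d)%:C by rewrite RRe_real// gtr0_real.
  by rewrite dE distrC nrmE ltcR.
apply/nbhs_normP; exists d%:C => /=; first by rewrite ltcR.
by move=> y /=; rewrite distrC nrmE ltcR => /dP.
Qed.

Lemma near0_nrmP Z (P : set Z) :
  (\forall x \near (0 : Z), P x) <->
  exists2 d : R, 0 < d & forall y, nrm y < d -> P y.
Proof.
split=> [/nbhs_nrmP[d d0 dP]|[d d0 dP]].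
  by exists d => // y yd; apply: dP; rewrite subr0.
by apply/nbhs_nrmP; exists d => // y; rewrite subr0 => /dP.
Qed.

Lemma cvg_nrmP Z (u : nat -> Z) (l : Z) :
  u @ \oo --> l <->
  forall eps : R, 0 < eps -> exists N, forall n, (N <= n)%N -> nrm (u n - l) < eps.
Proof.
split=> [ul eps eps0|H].
  have [|N _ HN] := ul [set y | nrm (y - l) < eps].
    by apply/nbhs_nrmP; exists eps.
  by exists N => n Nn; apply: HN.
move=> A /nbhs_nrmP[d d0 dA]; have [N HN] := H _ d0.
by exists N => // n /= Nn; apply: dA; exact: HN.
Qed.

Lemma continuous_nrmP Z Z' (F : Z -> Z') (x : Z) :
  {for x, continuous F} <->
  forall eps : R, 0 < eps ->
    exists2 d : R, 0 < d & forall y, nrm (y - x) < d -> nrm (F y - F x) < eps.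
Proof.
split=> [cF eps eps0|H].
  have := cF [set y | nrm (y - F x) < eps] => /(_ _)/nbhs_nrmP[|d d0 dP].
    by apply/nbhs_nrmP; exists eps.
  by exists d.
move=> A /nbhs_nrmP[d d0 dA]; have [d' d'0 H'] := H _ d0.
by apply/nbhs_nrmP; exists d' => // y /H'; exact: dA.
Qed.

End RealNorm.

Section BoundedLinear.
Context (R : realType).
Implicit Types (X Y Z W : normedModType R[i]).

Lemma blinDE X Y (S T : blin X Y) x : (S + T) x = S x + T x. Proof. by []. Qed.
Lemma blinNE X Y (S : blin X Y) x : (- S) x = - S x. Proof. by []. Qed.
Lemma blinBE X Y (S T : blin X Y) x : (S - T) x = S x - T x. Proof. by []. Qed.
Lemma blinZE X Y a (S : blin X Y) x : (a *: S) x = a *: S x. Proof. by []. Qed.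
Lemma blin0E X Y x : (0 : blin X Y) x = 0. Proof. by []. Qed.
Lemma blin_sumE X Y (I : Type) (r : seq I) (P : pred I) (F : I -> blin X Y) x :
  (\sum_(i <- r | P i) F i) x = \sum_(i <- r | P i) F i x.
Proof. by elim/big_rec2 : _ => // i y1 y2 _ <-. Qed.

Lemma blin_ext X Y (S T : blin X Y) : (forall x, S x = T x) -> S = T.
Proof. by move=> ST; apply: val_inj; apply/funext => x; exact: ST. Qed.

Lemma blin_nrm X Y (T : blin X Y) x : nrm (T x) <= nrm T * nrm x.
Proof. by rewrite -lecR rmorphM/= -!nrmE; exact: blin_normP. Qed.

Lemma blin_nrm_le X Y (T : blin X Y) M :
  0 <= M -> (forall x, nrm (T x) <= M * nrm x) -> nrm T <= M.
Proof.
move=> M0 TM; rewrite -lecR -nrmE; apply: blin_norm_le => x.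
rewrite !nrmE -[1](rmorph1 (real_complex R)) !lecR => x1.
by rewrite (le_trans (TM x))// ler_piMr.
Qed.

Lemma lipschitz_blin X Y (F : X -> Y) (M : R) :
  linear F -> (forall x, nrm (F x) <= M * nrm x) -> F \in @blin_pred R X Y.
Proof.
move=> lF FM; rewrite inE; split => // x.
have BF a b : F (a - b) = F a - F b.
  by have := lF (-1) b a; rewrite !scaleN1r => E; rewrite addrC E addrC.
apply/continuous_nrmP => eps eps0.
have M1 : 0 < `|M| + 1 by rewrite ltr_wpDl.
exists (eps / (`|M| + 1)); first by rewrite divr_gt0.
move=> y; rewrite ltr_pdivlMr// => yx.
rewrite -BF (le_lt_trans (FM _))// (le_lt_trans _ yx)// mulrC ler_wpM2l ?nrm_ge0//.
by rewrite (le_trans (ler_norm _))// lerDl.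
Qed.

Definition mkblin X Y (F : X -> Y) (M : R) (lF : linear F)
  (FM : forall x, nrm (F x) <= M * nrm x) : blin X Y :=
  Blin F (lipschitz_blin lF FM).

(** [frechet] is total, with default value 0; this relation records differentiability and the value
    of the derivative at once, with all bounds in [R]. *)
Definition hasD X Y (F : X -> Y) (x : X) (L : blin X Y) :=
  forall eps : R, 0 < eps -> exists2 d : R, 0 < d &
    forall h, nrm h < d -> nrm (F (x + h) - F x - L h) <= eps * nrm h.

Lemma frechetE X Y (F : X -> Y) x : differentiable F x ->
  frechet F x = 'd F x :> (X -> Y).
Proof. by rewrite /frechet; case: pselect. Qed.

Lemma hasDE X Y (F : X -> Y) x L :
  hasD F x L <-> F \o shift x = cst (F x) + L +o_ (0 : X) id.
Proof.
split=> [H|H].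
  apply/eqaddoP => eps eps0.
  have epsE : eps = (complex.Re eps)%:C by rewrite RRe_real// gtr0_real.
  have e0 : 0 < complex.Re eps by rewrite -ltcR -epsE.
  have [d d0 dP] := H _ e0.
  apply/near0_nrmP; exists d => // h /dP.
  rewrite epsE !nrmE -rmorphM lecR /=.
  rewrite !fctE /= (addrC h) opprD addrA; exact.
move/eqaddoP: H => H eps e0.
have := H eps%:C; rewrite ltcR => /(_ e0) /near0_nrmP[d d0 dP].
exists d => // h /dP; rewrite !nrmE -rmorphM lecR /=.
rewrite !fctE /= (addrC h) opprD addrA; exact.
Qed.

Lemma hasDP X Y (F : X -> Y) x L :
  hasD F x L <-> differentiable F x /\ frechet F x = L.
Proof.
rewrite hasDE; split=> [H|[dF <-]]; last first.
  by rewrite frechetE//; exact: diff_locally.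
have E := diff_unique (@blin_continuous _ _ _ L) H.
have dF : differentiable F x.
  apply/diff_locallyP; split; rewrite E//; exact: blin_continuous.
by split => //; apply: blin_ext => h; rewrite frechetE// E.
Qed.

Lemma hasD_diff X Y (F : X -> Y) x L : hasD F x L -> differentiable F x.
Proof. by move=> /hasDP[]. Qed.

Lemma hasD_frechet X Y (F : X -> Y) x L : hasD F x L -> frechet F x = L.
Proof. by move=> /hasDP[]. Qed.

Lemma diff_hasD X Y (F : X -> Y) x : differentiable F x -> hasD F x (frechet F x).
Proof. by move=> dF; apply/hasDP. Qed.

Lemma hasD_unique X Y (F : X -> Y) x L L' : hasD F x L -> hasD F x L' -> L = L'.
Proof. by move=> /hasD_frechet <- /hasD_frechet <-. Qed.

Lemma hasD_eq X Y (F G : X -> Y) x L :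
  (\forall y \near x, F y = G y) -> hasD F x L -> hasD G x L.
Proof.
move=> /nbhs_nrmP[d d0 FG] FL eps e0; have [d' d'0 H] := FL _ e0.
exists (Num.min d d'); first by rewrite lt_min d0.
move=> h; rewrite lt_min => /andP[hd hd'].
rewrite -!FG ?subrr ?nrm0//; first exact: H.
by rewrite addrC addKr.
Qed.

End BoundedLinear.

(** * Bounded bilinear maps and smoothness *)

Section Small.
Context (R : realType) (X : normedModType R[i]).
Implicit Types phi psi : X -> R.

(** Little-o of [nrm h], one-sided because it is applied to norms and their majorants. *)
Definition small phi := forall eps : R, 0 < eps -> exists2 d : R, 0 < d &
  forall h, nrm h < d -> phi h <= eps * nrm h.

Lemma smallD phi psi : small phi -> small psi -> small (fun h => phi h + psi h).
Proof.
move=> sphi spsi eps e0; have e20 : 0 < eps / 2 by rewrite divr_gt0.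
have [d d0 H] := sphi _ e20; have [d' d'0 H'] := spsi _ e20.
exists (Num.min d d'); first by rewrite lt_min d0.
move=> h; rewrite lt_min => /andP[/H Hh /H' Hh']; lra.
Qed.

Lemma smallM (C : R) phi : 0 <= C -> small phi -> small (fun h => C * phi h).
Proof.
move=> C0 sphi eps e0; have C1 : 0 < C + 1 by lra.
have [d d0 H] := sphi _ (divr_gt0 e0 C1).
exists d => // h /H Hh; rewrite (le_trans (ler_wpM2l C0 Hh))//.
rewrite mulrA ler_wpM2r ?nrm_ge0// mulrCA ler_piMr ?(ltW e0)//.
by rewrite ler_pdivrMr//; lra.
Qed.

Lemma small_sq (C : R) : 0 <= C -> small (fun h => C * nrm h ^+ 2).
Proof.
move=> C0 eps e0; have C1 : 0 < C + 1 by lra.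
exists (eps / (C + 1)); first by rewrite divr_gt0.
move=> h; rewrite ltr_pdivlMr// => hd.
by have := nrm_ge0 h; nra.
Qed.

Lemma small_le (d : R) phi psi : 0 < d ->
  (forall h, nrm h < d -> phi h <= psi h) -> small psi -> small phi.
Proof.
move=> d0 H sp eps e0; have [d' d'0 H'] := sp _ e0.
exists (Num.min d d'); first by rewrite lt_min d0.
by move=> h; rewrite lt_min => /andP[/H Hh /H'/(le_trans Hh)].
Qed.

Lemma hasD_small (Y : normedModType R[i]) (F : X -> Y) x L :
  hasD F x L <-> small (fun h => nrm (F (x + h) - F x - L h)).
Proof. by []. Qed.

Lemma hasD_lipschitz (Y : normedModType R[i]) (F : X -> Y) x L : hasD F x L ->
  exists2 d : R, 0 < d &
    forall h, nrm h < d -> nrm (F (x + h) - F x) <= (nrm L + 1) * nrm h.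
Proof.
move=> /(_ 1 ltr01)[d d0 H]; exists d => // h /H Hh.
have -> : F (x + h) - F x = (F (x + h) - F x - L h) + L h by rewrite subrK.
rewrite (le_trans (nrmD _ _))// mulrDl addrC lerD// blin_nrm //.
Qed.

Lemma hasD_cont (Y : normedModType R[i]) (F : X -> Y) x L : hasD F x L ->
  {for x, continuous F}.
Proof. by move=> /hasD_diff/differentiable_continuous. Qed.

End Small.

Section Calculus.
Context (R : realType).
Implicit Types (X Y Z W : normedModType R[i]).

Lemma linear_funB X Y (F : X -> Y) : linear F -> {morph F : x y / x - y}.
Proof.
by move=> lF x y; have E := lF (-1) y x; rewrite addrC -scaleN1r E scaleN1r addrC.
Qed.

Lemma hasD_cst X Y (c : Y) (x : X) : hasD (fun=> c) x 0.
Proof.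
move=> eps e0; exists 1 => // h _.
by rewrite subrr blin0E subr0 nrm0 mulr_ge0 ?nrm_ge0// ltW.
Qed.

Lemma hasD_blin X Y (T : blin X Y) (x : X) : hasD T x T.
Proof.
move=> eps e0; exists 1 => // h _.
by rewrite linearD [T x + _]addrC addrK subrr nrm0 mulr_ge0 ?nrm_ge0// ltW.
Qed.

Lemma hasD_id X (x : X) : hasD (fun y => y) x (blin_id X).
Proof. exact: (hasD_blin (blin_id X)). Qed.

Lemma hasDD X Y (F G : X -> Y) x L M :
  hasD F x L -> hasD G x M -> hasD (fun y => F y + G y) x (L + M).
Proof.
move=> /hasD_small FL /hasD_small GM; apply: small_le (smallD FL GM) => // h _.
by rewrite (le_trans _ (nrmD _ _))// blinDE !opprD (addrACA (F _)) (addrACA (F _ - _)).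
Qed.

Lemma hasDZ X Y (a : R[i]) (F : X -> Y) x L :
  hasD F x L -> hasD (fun y => a *: F y) x (a *: L).
Proof.
move=> /hasD_small FL; apply: small_le (smallM (nrm_ge0 (a : R[i]^o)) FL) => // h _.
by rewrite blinZE -!scalerBr nrmZ.
Qed.

Lemma hasD_sum X Y (I : Type) (r : seq I) (F : I -> X -> Y) x (L : I -> blin X Y) :
  (forall i, hasD (F i) x (L i)) ->
  hasD (fun y => \sum_(i <- r) F i y) x (\sum_(i <- r) L i).
Proof.
move=> FL; elim: r => [|i r IH].
  rewrite big_nil; under eq_fun do rewrite big_nil; exact: hasD_cst.
rewrite big_cons; under eq_fun do rewrite big_cons; exact: hasDD (FL i) IH.
Qed.

Lemma bcomp_subproof X Y Z (T : blin Y Z) (S : blin X Y) :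
  (fun x => T (S x)) \in @blin_pred R X Z.
Proof.
apply: (lipschitz_blin (M := nrm T * nrm S)); first by move=> a x y; rewrite !linearP.
move=> x; rewrite (le_trans (blin_nrm _ _))// -mulrA ler_wpM2l ?nrm_ge0//.
exact: blin_nrm.
Qed.
Definition bcomp X Y Z (T : blin Y Z) (S : blin X Y) : blin X Z :=
  Blin (fun x => T (S x)) (bcomp_subproof T S).

Lemma hasD_comp X Y Z (F : Y -> Z) (G : X -> Y) x L M :
  hasD F (G x) L -> hasD G x M -> hasD (fun y => F (G y)) x (bcomp L M).
Proof.
move=> /hasDP[dF FL] /hasDP[dG GM]; apply/hasDP.
have dFG : differentiable (fun y => F (G y)) x by exact: differentiable_comp.
split => //; apply: blin_ext => h; rewrite frechetE//.
by rewrite (diff_comp dG dF) /= -FL -GM !frechetE.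
Qed.

Lemma hasD_shift X Y (F : X -> Y) a x L :
  hasD F (x + a) L -> hasD (fun y => F (y + a)) x L.
Proof.
move=> FL eps e0; have [d d0 H] := FL _ e0.
by exists d => // h /H; rewrite (addrAC x h).
Qed.

(** Application, composition and scaling are all products of this kind. The two halves of the
    product rule, [bil_appl] and [bil_appr], are again bounded bilinear, with values in operator
    spaces, so one induction over all such [B] covers every order of differentiation. *)
Definition bbilin Y Z W (B : Y -> Z -> W) :=
  [/\ forall z, linear (B^~ z), forall y, linear (B y) &
      exists2 M : R, 0 <= M & forall y z, nrm (B y z) <= M * nrm y * nrm z].

Section BoundedBilinear.
Variables (X Y Z W : normedModType R[i]) (B : Y -> Z -> W).
Hypothesis bB : bbilin B.

Lemma bil_appl_subproof (T : blin X Y) z : (fun h => B (T h) z) \in @blin_pred R X W.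
Proof.
have [l1 l2 [M M0 HM]] := bB.
apply: (lipschitz_blin (M := M * nrm T * nrm z)).
  by move=> a x y; rewrite linearP l1.
move=> x; rewrite (le_trans (HM _ _))// [leRHS]mulrAC ler_wpM2r ?nrm_ge0//.
by rewrite -mulrA ler_wpM2l// blin_nrm.
Qed.
Definition bil_appl (T : blin X Y) z : blin X W := Blin _ (bil_appl_subproof T z).

Lemma bil_appr_subproof y (T : blin X Z) : (fun h => B y (T h)) \in @blin_pred R X W.
Proof.
have [l1 l2 [M M0 HM]] := bB.
apply: (lipschitz_blin (M := M * nrm y * nrm T)).
  by move=> a x x'; rewrite linearP l2.
move=> x; rewrite (le_trans (HM _ _))// -[leRHS]mulrA ler_wpM2l// ?blin_nrm//.
by rewrite mulr_ge0// nrm_ge0.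
Qed.
Definition bil_appr y (T : blin X Z) : blin X W := Blin _ (bil_appr_subproof y T).

Lemma hasD_bil (u : X -> Y) (v : X -> Z) x u' v' : hasD u x u' -> hasD v x v' ->
  hasD (fun y => B (u y) (v y)) x (bil_appl u' (v x) + bil_appr (u x) v').
Proof.
have [l1 l2 [M M0 HM]] := bB.
move=> Du Dv; have [d d0 Hd] := hasD_lipschitz Dv.
set K := nrm v' + 1 in Hd.
have K0 : 0 <= K by rewrite addr_ge0 ?nrm_ge0.
(* By the Lipschitz estimate, [C] bounds [M * nrm (v (x + h))] for [nrm h < d]. *)
pose C := M * (nrm (v x) + K * d).
have C0 : 0 <= C by rewrite mulr_ge0// addr_ge0 ?nrm_ge0// mulr_ge0// ltW.
have D0 : 0 <= M * nrm (u x) by rewrite mulr_ge0// nrm_ge0.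
have E0 : 0 <= M * nrm u' * K by rewrite mulr_ge0// mulr_ge0// nrm_ge0.
apply/hasD_small.
apply: (small_le d0 _
  (smallD (smallD (smallM C0 Du) (small_sq X E0)) (smallM D0 Dv))) => h hd.
set ru := u (x + h) - u x - u' h; set rv := v (x + h) - v x - v' h.
(* Outer terms: a little-o remainder against a bounded factor. Middle term: a product of two
   increments, hence quadratic in [h]. *)
have -> : B (u (x + h)) (v (x + h)) - B (u x) (v x) -
    (bil_appl u' (v x) + bil_appr (u x) v') h =
    B ru (v (x + h)) + B (u' h) (v (x + h) - v x) + B (u x) rv.
  rewrite blinDE /= /ru /rv !(linear_funB (l1 _)) !(linear_funB (l2 _)).
  symmetry; rewrite [X in X + _]addrA subrK [X in X + _ = _]addrAC.
  by rewrite -[X in _ + X = _]addrA [LHS]addrA subrK addrACA opprD.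
rewrite (le_trans (nrmD _ _))// lerD//.
rewrite (le_trans (nrmD _ _))// lerD//.
  rewrite (le_trans (HM _ _))// /C mulrAC ler_wpM2r ?nrm_ge0// ler_wpM2l//.
  have -> : v (x + h) = v x + (v (x + h) - v x) by rewrite addrCA subrr addr0.
  rewrite (le_trans (nrmD _ _))// lerD// (le_trans (Hd _ hd))// ler_wpM2l//.
  exact: ltW.
rewrite (le_trans (HM _ _))//.
rewrite (le_trans (ler_pM _ _ (ler_wpM2l M0 (blin_nrm u' h)) (Hd _ hd)))//.
- by rewrite mulr_ge0// nrm_ge0.
- exact: nrm_ge0.
by rewrite expr2; set p := nrm h; set q := nrm u'; lra.
Qed.

End BoundedBilinear.

Lemma bil_appl_bbilin X Y Z W (B : Y -> Z -> W) (bB : bbilin B) :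
  bbilin (bil_appl (X := X) bB).
Proof.
have [l1 l2 [M M0 HM]] := bB; split.
- by move=> z a S T; apply: blin_ext => h; exact: l1.
- by move=> S a z z'; apply: blin_ext => h; exact: l2.
exists M => // T z; apply: blin_nrm_le; first by rewrite !mulr_ge0// nrm_ge0.
move=> h /=; rewrite (le_trans (HM _ _))// [leRHS]mulrAC ler_wpM2r ?nrm_ge0//.
by rewrite -mulrA ler_wpM2l// blin_nrm.
Qed.

Lemma bil_appr_bbilin X Y Z W (B : Y -> Z -> W) (bB : bbilin B) :
  bbilin (bil_appr (X := X) bB).
Proof.
have [l1 l2 [M M0 HM]] := bB; split.
- by move=> z a S T; apply: blin_ext => h; exact: l1.
- by move=> S a z z'; apply: blin_ext => h; exact: l2.
exists M => // T z; apply: blin_nrm_le; first by rewrite !mulr_ge0// nrm_ge0.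
move=> h /=; rewrite (le_trans (HM _ _))// -[leRHS]mulrA ler_wpM2l ?blin_nrm//.
by rewrite mulr_ge0// nrm_ge0.
Qed.

Lemma bcomp_bbilin X Y Z : bbilin (@bcomp X Y Z).
Proof.
split.
- by move=> z a S T; apply: blin_ext.
- by move=> S a z z'; apply: blin_ext => h; exact: linearP.
exists 1 => // T S; rewrite mul1r.
apply: blin_nrm_le; first by rewrite mulr_ge0// nrm_ge0.
move=> h /=; rewrite (le_trans (blin_nrm _ _))// -mulrA ler_wpM2l ?nrm_ge0//.
exact: blin_nrm.
Qed.

Lemma bapp_bbilin X Y : bbilin (fun (T : blin X Y) x => T x).
Proof.
split => [z a S T|T a x y|]; [by []|by rewrite linearP|].
by exists 1 => // T x; rewrite mul1r blin_nrm.
Qed.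

Lemma hasD_app X Y Z (u : X -> blin Y Z) (v : X -> Y) x u' v' h :
  hasD u x u' -> hasD v x v' ->
  exists2 L, hasD (fun y => u y (v y)) x L & L h = u' h (v x) + u x (v' h).
Proof.
by move=> Du Dv; eexists; first exact: (hasD_bil (@bapp_bbilin Y Z) Du Dv).
Qed.

End Calculus.

Section Smooth.
Context (R : realType) (X : normedModType R[i]).
Implicit Types (D : set X).

(** The recursion replaces [F] by [frechet F] and so changes the codomain; inductions on [k]
    therefore generalize over [Y]. *)
Fixpoint smooth (k : nat) (Y : normedModType R[i]) D (F : X -> Y) : Prop :=
  if k is k'.+1 then
    (forall x, D x -> differentiable F x) /\ smooth k' D (frechet F)
  else True.

Lemma smooth_sub k (Y : normedModType R[i]) D D' (F : X -> Y) :
  D' `<=` D -> smooth k D F -> smooth k D' F.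
Proof.
move=> DD'; elim: k Y F => //= k IH Y F [dF /IH sF].
by split=> // x /DD'/dF.
Qed.

Lemma smooth_leS k (Y : normedModType R[i]) D (F : X -> Y) :
  smooth k.+1 D F -> smooth k D F.
Proof.
elim: k Y F => // k IH Y F [dF sF].
by split => //; exact: IH.
Qed.

Lemma eq_smooth k (Y : normedModType R[i]) D (F G : X -> Y) :
  open D -> (forall x, D x -> F x = G x) -> smooth k D F -> smooth k D G.
Proof.
move=> oD; elim: k Y F G => //= k IH Y F G FG [dF sF].
have H x : D x -> hasD G x (frechet F x).
  move=> Dx; apply: (hasD_eq _ (diff_hasD (dF _ Dx))).
  by apply: filterS FG _; exact: open_nbhs_nbhs.
split=> [x /H/hasD_diff//|].
by apply: IH sF => x /H/hasD_frechet.
Qed.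

Lemma smooth_hasD k (Y : normedModType R[i]) D (F : X -> Y) F' :
  open D -> (forall x, D x -> hasD F x (F' x)) -> smooth k D F' -> smooth k.+1 D F.
Proof.
move=> oD H s; split=> [x /H/hasD_diff//|].
by apply: eq_smooth s => // x /H/hasD_frechet.
Qed.

Lemma smooth_hasDE k (Y : normedModType R[i]) D (F : X -> Y) x :
  smooth k.+1 D F -> D x -> hasD F x (frechet F x).
Proof. by move=> [dF _] /dF/diff_hasD. Qed.

Lemma smooth_cst k (Y : normedModType R[i]) D (c : Y) :
  open D -> smooth k D (fun=> c).
Proof.
move=> oD; elim: k Y c => // k IH Y c.
apply: (@smooth_hasD _ _ _ _ (fun=> 0)) => // x _; exact: hasD_cst.
Qed.

Lemma smooth_blin k (Y : normedModType R[i]) D (T : blin X Y) :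
  open D -> smooth k D T.
Proof.
move=> oD; case: k => // k.
apply: (@smooth_hasD _ _ _ _ (fun=> T)) => // [x _|]; last exact: smooth_cst.
exact: hasD_blin.
Qed.

Lemma smooth_id k D : open D -> smooth k D (fun x => x).
Proof. exact: (@smooth_blin k X D (blin_id X)). Qed.

Lemma smoothD k (Y : normedModType R[i]) D (F G : X -> Y) :
  open D -> smooth k D F -> smooth k D G -> smooth k D (fun x => F x + G x).
Proof.
move=> oD; elim: k Y F G => // k IH Y F G sF sG.
apply: (smooth_hasD (F' := fun x => frechet F x + frechet G x)) => //.
- by move=> x Dx; exact: hasDD (smooth_hasDE sF Dx) (smooth_hasDE sG Dx).
- by apply: IH; [case: sF|case: sG].
Qed.

Lemma smooth_bil k (Y Z W : normedModType R[i]) D (B : Y -> Z -> W) u v :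
  open D -> bbilin B -> smooth k D u -> smooth k D v ->
  smooth k D (fun x => B (u x) (v x)).
Proof.
move=> oD; elim: k Y Z W B u v => // k IH Y Z W B u v bB su sv.
apply: (smooth_hasD
  (F' := fun x => bil_appl bB (frechet u x) (v x) + bil_appr bB (u x) (frechet v x))) => //.
- by move=> x Dx; exact: hasD_bil (smooth_hasDE su Dx) (smooth_hasDE sv Dx).
- apply: smoothD => //; apply: IH.
  + exact: bil_appl_bbilin.
  + by case: su.
  + exact: smooth_leS.
  + exact: bil_appr_bbilin.
  + exact: smooth_leS.
  + by case: sv.
Qed.

Lemma smooth_comp k (Y : normedModType R[i]) D D' (F : X -> Y) (G : X -> X) :
  open D -> open D' -> (forall x, D' x -> D (G x)) ->
  smooth k D F -> smooth k D' G -> smooth k D' (fun x => F (G x)).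
Proof.
move=> oD oD' GD; elim: k Y F => // k IH Y F sF sG.
apply: (smooth_hasD (F' := fun x => bcomp (frechet F (G x)) (frechet G x))) => //.
- move=> x D'x; apply: hasD_comp; last exact: smooth_hasDE sG D'x.
  exact: smooth_hasDE sF (GD _ D'x).
- apply: smooth_bil => //; first exact: bcomp_bbilin.
  + by apply: IH; [case: sF|exact: smooth_leS].
  + by case: sG.
Qed.

End Smooth.

(** * Geometric series and roots of unity *)

Section GeometricSeries.
Context (R : realType).
Implicit Types (X Y Z : normedModType R[i]).

Lemma lim_uniq Y (u : nat -> Y) (a b : Y) : u @ \oo --> a -> u @ \oo --> b -> a = b.
Proof. by move=> ua ub; exact: (cvg_unique (@norm_hausdorff _ Y) ua ub). Qed.

Lemma half_exp_small (M eps : R) : 0 < eps -> exists m, M * 2^-1 ^+ m < eps.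
Proof.
move=> e0.
have /cvgrPdist_lt : (fun n : nat => 2^-1 ^+ n : R) @ \oo --> 0.
  by apply: cvg_expr; rewrite ger0_norm ?invr_ge0// invf_lt1// ltr1n.
have M0 : 0 < `|M| + 1 by rewrite ltr_wpDl.
move=> /(_ _ (divr_gt0 e0 M0))[m _ /(_ m (leqnn m))] /=.
rewrite sub0r normrN ger0_norm ?exprn_ge0 ?invr_ge0// ltr_pdivlMr// => Hm.
exists m; rewrite (le_lt_trans _ Hm)// mulrC ler_wpM2l ?exprn_ge0 ?invr_ge0//.
by rewrite (le_trans (ler_norm _))// lerDl.
Qed.

Lemma series_tail Y (u : nat -> Y) (M : R) m n :
  (forall k, nrm (u k) <= M * 2^-1 ^+ k) -> (m <= n)%N ->
  nrm (series u n - series u m) <= 2 * M * 2^-1 ^+ m.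
Proof.
move=> uM mn.
have M0 : 0 <= M.
  by have := le_trans (nrm_ge0 _) (uM 0%N); rewrite expr0 mulr1.
(* Strengthened to the exact geometric sum, for which the induction on [n] closes. *)
suff : nrm (series u n - series u m) <= 2 * M * (2^-1 ^+ m - 2^-1 ^+ n).
  have : 0 <= 2 * M * 2^-1 ^+ n by rewrite !mulr_ge0// exprn_ge0// invr_ge0.
  lra.
elim: n mn => [|n IH]; first by rewrite leqn0 => /eqP ->; rewrite !subrr mulr0 nrm0.
rewrite leq_eqVlt => /predU1P[->|/IH {}IH]; first by rewrite !subrr mulr0 nrm0.
have -> : series u n.+1 - series u m = series u n - series u m + u n.
  by rewrite /series /= big_nat_recr//= addrAC.
rewrite (le_trans (nrmD _ _))// (le_trans (lerD IH (uM n)))//.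
by rewrite exprS; lra.
Qed.

Lemma series_lim_tail Y (u : nat -> Y) (M : R) (l : Y) n :
  (forall k, nrm (u k) <= M * 2^-1 ^+ k) -> series u @ \oo --> l ->
  nrm (l - series u n) <= 2 * M * 2^-1 ^+ n.
Proof.
move=> uM ul; apply/ler_addgt0Pr => eps eps0.
have [N HN] := (cvg_nrmP _ _).1 ul _ eps0.
have := HN (maxn N n) (leq_maxl _ _); rewrite nrmBC => H1.
have H2 := series_tail uM (leq_maxr N n).
have -> : l - series u n =
  (series u (maxn N n) - series u n) + (l - series u (maxn N n)).
  by rewrite [RHS]addrC addrA subrK.
by rewrite (le_trans (nrmD _ _))// lerD// ltW.
Qed.

Lemma series_lim_bound Y (u : nat -> Y) (M : R) (l : Y) :
  (forall k, nrm (u k) <= M * 2^-1 ^+ k) -> series u @ \oo --> l ->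
  nrm l <= 2 * M.
Proof.
move=> uM ul; have := series_lim_tail 0 uM ul.
by rewrite /series /= big_geq// subr0 expr0 mulr1.
Qed.

(** The fragment of completeness that the power series arguments use; it passes from [Y] to
    [blin X Y], hence to all spaces of multilinear operators. *)
Definition geometric_complete Y := forall (u : nat -> Y) (M : R),
  (forall k, nrm (u k) <= M * 2^-1 ^+ k) -> exists l : Y, series u @ \oo --> l.

Lemma complete_geometric (X : completeNormedModType R[i]) : geometric_complete X.
Proof.
move=> u M uM; apply/cvg_ex; apply: cauchy_cvg; apply: cauchy_exP => eps eps0.
have e0 : 0 < complex.Re eps by move: eps0; rewrite ltcE => /andP[].
have [m Hm] := half_exp_small (2 * M) e0.
exists (series u m); exists m => // n /= mn.
rewrite -ball_normE /= -[eps]RRe_real ?gtr0_real// nrmE ltcR nrmBC.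
exact: le_lt_trans (series_tail uM mn) Hm.
Qed.

(** The pointwise sums are linear in [x] and bounded by [2 * M * nrm x]; since the tail bounds are
    proportional to [nrm x], convergence holds in operator norm. *)
Lemma blin_geometric X Y : geometric_complete Y -> geometric_complete (blin X Y).
Proof.
move=> gY u M uM.
have ub x k : nrm (u k x) <= (M * nrm x) * 2^-1 ^+ k.
  by rewrite (le_trans (blin_nrm _ _))// mulrAC ler_wpM2r// nrm_ge0.
have [S HS] := choice (fun x => gY _ _ (ub x)).
have lS : linear S.
  move=> a x y; apply: lim_uniq (HS _) _.
  have -> : series (fun k => u k (a *: x + y)) =
            (fun n => a *: series (fun k => u k x) n + series (fun k => u k y) n).
    apply/funext => n; rewrite /series /= scaler_sumr -big_split /=.
    by apply: eq_bigr => k _; rewrite linearP.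
  by apply: cvgD => //; apply: cvgZl_tmp.
have SM x : nrm (S x) <= (2 * M) * nrm x.
  by rewrite -mulrA; exact: series_lim_bound (HS x).
exists (mkblin lS SM); apply/cvg_nrmP => eps eps0.
have [m Hm] := half_exp_small (2 * M) eps0.
have M0 : 0 <= M.
  by have := le_trans (nrm_ge0 _) (uM 0%N); rewrite expr0 mulr1.
exists m => n mn; rewrite (le_lt_trans _ Hm)//.
have H : nrm (series u n - mkblin lS SM) <= 2 * M * 2^-1 ^+ n.
  apply: blin_nrm_le; first by rewrite !mulr_ge0// exprn_ge0// invr_ge0.
  move=> x; rewrite blinBE /series /= blin_sumE nrmBC.
  have := series_lim_tail n (ub x) (HS x).
  by rewrite /series /= mulrA mulrAC.
rewrite (le_trans H)// ler_wpM2l ?mulr_ge0//.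
by apply: ler_wiXn2l => //; rewrite ?invr_ge0// invf_le1// ler1n.
Qed.

Lemma series_blin X Y (T : blin X Y) (u : nat -> X) (l : X) :
  series u @ \oo --> l -> series (fun k => T (u k)) @ \oo --> T l.
Proof.
move=> ul; have -> : series (fun k => T (u k)) = T \o series u.
  by apply/funext => n; rewrite /series /= linear_sum.
by apply: continuous_cvg => //; exact: blin_continuous.
Qed.

Lemma series_app X Y (u : nat -> blin X Y) (S : blin X Y) x :
  series u @ \oo --> S -> series (fun k => u k x) @ \oo --> S x.
Proof.
move=> /cvg_nrmP uS; apply/cvg_nrmP => eps eps0.
have n1 : 0 < nrm x + 1 by rewrite ltr_wpDl ?nrm_ge0.
have [N HN] := uS _ (divr_gt0 eps0 n1); exists N => n /HN.
rewrite ltr_pdivlMr// => H; rewrite (le_lt_trans _ H)//.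
have -> : series (fun k => u k x) n - S x = (series u n - S) x.
  by rewrite blinBE /series /= blin_sumE.
by rewrite (le_trans (blin_nrm _ _))// ler_wpM2l ?nrm_ge0// lerDl.
Qed.

End GeometricSeries.

Section RootsOfUnity.
Context (R : realType).

(** [X^n - 1] splits and is separable, so it has [n] distinct roots, and a group of [n] such roots
    in a field is cyclic. *)
Lemma prim_root_ex n : (0 < n)%N -> exists w : R[i], n.-primitive_root w.
Proof.
move=> n0; pose p : {poly R[i]} := 'X^n - 1.
have [r pE] := closed_field_poly_normal p.
have {}pE : p = \prod_(z <- r) ('X - z%:P).
  by rewrite pE (monicP _) ?scale1r// monicXnsubC.
have szr : (n <= size r)%N by rewrite -ltnS -(size_prod_XsubC r id) -pE size_XnsubC.
have ur : uniq r.
  by rewrite -separable_prod_XsubC -pE separable_Xn_sub_1 // pnatr_eq0 -lt0n.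
have rr : all n.-unity_root r by apply/allP => z; rewrite -root_prod_XsubC -pE.
by have /hasP[w _ pw] := has_prim_root n0 rr ur szr; exists w.
Qed.

Lemma prim_root_nrm n (w : R[i]) : n.-primitive_root w -> nrm (w : R[i]^o) = 1.
Proof.
move=> pw; have n0 := prim_order_gt0 pw.
apply/eqP; rewrite -(@pexpr_eq1 _ _ n) ?nrm_ge0//.
by rewrite -nrmCX prim_expr_order// nrmC1.
Qed.

(** The sum is geometric with ratio [z = w^j / w^k]; for [j != k], [z] differs from 1 while
    [z^n = 1]. *)
Lemma sum_root_unity n (w : R[i]) j k : n.-primitive_root w -> (j < n)%N -> (k < n)%N ->
  \sum_(i < n) w ^- (i * k) * w ^+ (i * j) = if j == k then n%:R else 0.
Proof.
move=> pw jn kn; have w0 : w != 0.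
  apply/eqP => w0; have := prim_expr_order pw; have := prim_order_gt0 pw.
  by rewrite w0; case: (n) => // m _ /eqP; rewrite exprS mul0r eq_sym oner_eq0.
pose z := w ^+ j / w ^+ k.
have zE (i : 'I_n) : w ^- (i * k) * w ^+ (i * j) = z ^+ i.
  by rewrite expr_div_n -!exprM mulrC ![(i * _)%N]mulnC.
under eq_bigr do rewrite zE.
case: eqP => [jk|/eqP jk].
  have -> : z = 1 by rewrite /z jk divff// expf_neq0.
  by under eq_bigr do rewrite expr1n; rewrite sumr_const card_ord.
have z1 : z - 1 != 0.
  rewrite subr_eq0 /z; apply/eqP => /divr1_eq/eqP.
  by rewrite (eq_prim_root_expr pw) !modn_small// (negPf jk).
apply: (mulfI z1); rewrite mulr0 -subrX1.
rewrite /z expr_div_n -!exprM ![(_ * n)%N]mulnC !exprM (prim_expr_order pw) !expr1n.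
by rewrite divr1 subrr.
Qed.

Lemma dft (Y : lmodType R[i]) n (w : R[i]) (p : R[i] -> Y) (a : nat -> Y) k :
  n.-primitive_root w -> (k < n)%N -> (forall t, p t = \sum_(j < n) t ^+ j *: a j) ->
  n%:R^-1 *: \sum_(i < n) w ^- (i * k) *: p (w ^+ i) = a k.
Proof.
move=> pw kn pE.
under eq_bigr => i _.
  rewrite pE scaler_sumr; under eq_bigr do rewrite scalerA -exprM; over.
rewrite exchange_big /=; under eq_bigr => j _.
  rewrite -scaler_suml sum_root_unity//; over.
rewrite (bigD1 (Ordinal kn)) //= eqxx big1 => [|j jk]; last first.
  by rewrite ifN ?scale0r//; move: jk; rewrite -val_eqE.
by rewrite addr0 scalerA mulVf ?scale1r// pnatr_eq0 -lt0n (prim_order_gt0 pw).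
Qed.

End RootsOfUnity.

(** * Polynomials on complex lines *)

Section LinePolynomials.
Context (R : realType) (X : normedModType R[i]).
Implicit Types Y : normedModType R[i].

Definition fcoef Y (N : nat) (w : R[i]) (q : X -> Y) (j : nat) (x h : X) : Y :=
  N%:R^-1 *: \sum_(i < N) w ^- (i * j) *: q (x + w ^+ i *: h).

(* [q] is a polynomial on every complex line, its coefficients there being the
   discrete Fourier coefficients of its values. In this form the property is a
   linear identity between translates of [q], hence it passes to derivatives. *)
Definition line_poly Y (q : X -> Y) := exists N (w : R[i]),
  [/\ (1 < N)%N, nrm (w : R[i]^o) = 1 &
      forall x h t, q (x + t *: h) = \sum_(j < N) t ^+ j *: fcoef N w q j x h].

Lemma fcoef_le Y N w (q : X -> Y) j x h (B : R) : (0 < N)%N ->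
  nrm (w : R[i]^o) = 1 ->
  (forall i : nat, nrm (q (x + w ^+ i *: h)) <= B) -> nrm (fcoef N w q j x h) <= B.
Proof.
move=> N0 w1 qB; rewrite nrmZ nrmCV nrmC_nat.
rewrite ler_pdivrMl ?ltr0n// (le_trans (nrm_sum _ _ _))//.
apply: (@le_trans _ _ (\sum_(i < N) B)).
  by apply: ler_sum => i _; rewrite nrmZ nrmCV nrmCX w1 expr1n invr1 mul1r.
by rewrite sumr_const card_ord mulr_natl.
Qed.

Lemma line_poly_coef Y (q : X -> Y) :
  (exists N, forall x h, exists a : nat -> Y,
    forall t, q (x + t *: h) = \sum_(j < N) t ^+ j *: a j) -> line_poly q.
Proof.
(* The order [N.+2] guarantees that a coefficient of index 1 exists; the surplus coefficients are
   padded with 0. *)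
move=> [N H]; have [w pw] := @prim_root_ex R N.+2 isT.
exists N.+2, w; split => //; first exact: prim_root_nrm pw.
move=> x h; have [a aE] := H x h.
pose b j := if (j < N)%N then a j else 0.
have bE t : q (x + t *: h) = \sum_(j < N.+2) t ^+ j *: b j.
  have b0 : b N = 0 by rewrite /b ltnn.
  have b1 : b N.+1 = 0 by rewrite /b ltnNge leqnSn.
  rewrite aE 2!big_ord_recr /= b0 b1 !scaler0 !addr0.
  by apply: eq_bigr => j _; rewrite /b ltn_ord.
move=> t; rewrite bE; apply: eq_bigr => j _.
by rewrite /fcoef (dft pw _ bE).
Qed.

Lemma line_poly_frechet Y (q : X -> Y) : line_poly q ->
  (forall x, differentiable q x) -> line_poly (frechet q).
Proof.
move=> [N [w [N1 w1 qE]]] dq; exists N, w; split => // x h t.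
have Dq a : hasD (fun y => q (y + a)) x (frechet q (x + a)).
  by apply: hasD_shift; exact: diff_hasD.
apply: hasD_unique (Dq (t *: h)) _.
under eq_fun do rewrite qE.
apply: (@hasD_sum _ _ _ _ _ (fun (j : 'I_N) y => t ^+ j *: fcoef N w q j y h)
  x (fun j => t ^+ j *: fcoef N w (frechet q) j x h)) => j.
do 2 apply: hasDZ.
apply: (@hasD_sum _ _ _ _ _
  (fun (i : 'I_N) y => w ^- (i * j) *: q (y + w ^+ i *: h))
  x (fun i => w ^- (i * j) *: frechet q (x + w ^+ i *: h))) => i.
exact: hasDZ.
Qed.

Lemma line_remainder Y (c : nat -> Y) N (M : R) (t : R[i]) m :
  nrm (t : R[i]^o) <= 2^-1 -> (forall j, nrm (c j) <= M) ->
  nrm (\sum_(j < N) t ^+ (j + m) *: c j) <= 2 * M * nrm (t : R[i]^o) ^+ m.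
Proof.
move=> t2 cM; have M0 : 0 <= M := le_trans (nrm_ge0 _) (cM 0%N).
have -> : \sum_(j < N) t ^+ (j + m) *: c j = series (fun j => t ^+ (j + m) *: c j) N.
  by rewrite /series /= big_mkord.
have H k : nrm (t ^+ (k + m) *: c k) <= (M * nrm (t : R[i]^o) ^+ m) * 2^-1 ^+ k.
  rewrite nrmZ nrmCX exprD -mulrA mulrC.
  rewrite ler_pM ?mulr_ge0 ?exprn_ge0 ?nrm_ge0//.
    by rewrite mulrC ler_wpM2r ?exprn_ge0 ?nrm_ge0.
  by rewrite lerXn2r ?nnegrE ?nrm_ge0 ?invr_ge0.
have := series_tail H (leq0n N).
by rewrite {2}/series /= big_geq// subr0 expr0 mulr1 mulrA.
Qed.

Lemma line_expansion Y N w (q : X -> Y) :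
  (1 < N)%N -> nrm (w : R[i]^o) = 1 ->
  (forall x h t, q (x + t *: h) = \sum_(j < N) t ^+ j *: fcoef N w q j x h) ->
  forall x h t, q (x + t *: h) = q x + t *: fcoef N w q 1 x h +
     \sum_(j < N.-2) t ^+ (j + 2) *: fcoef N w q j.+2 x h.
Proof.
case: N => // -[]// N _ w1 qE x h t.
have q0 : q x = fcoef N.+2 w q 0 x h.
  have := qE x h 0; rewrite scale0r addr0 big_ord_recl expr0 scale1r.
  by rewrite big1 ?addr0// => j _; rewrite expr0n scale0r.
rewrite qE !big_ord_recl /= expr0 scale1r expr1 -q0 addrA; congr (_ + _).
by apply: eq_bigr => j _; rewrite addn2 /bump /= !add1n.
Qed.

(** The right side is the coefficient of [t] in the line identity; comparing it with the first-order
    expansion at [x] along [s h] and dividing by a small real [s > 0] identifies the two. *)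
Lemma frechet_fcoef Y N w (q : X -> Y) x h :
  (1 < N)%N -> nrm (w : R[i]^o) = 1 ->
  (forall x h t, q (x + t *: h) = \sum_(j < N) t ^+ j *: fcoef N w q j x h) ->
  differentiable q x -> frechet q x h = fcoef N w q 1 x h.
Proof.
move=> N1 w1 qE dq; have [B HB] : exists B, forall j, nrm (fcoef N w q j x h) <= B.
  exists (\sum_(i < N) nrm (q (x + w ^+ i *: h))) => j.
  rewrite nrmZ nrmCV nrmC_nat ler_pdivrMl ?ltr0n ?(ltn_trans _ N1)//.
  rewrite (le_trans (nrm_sum _ _ _))//.
  apply: (@le_trans _ _ (\sum_(i < N) nrm (q (x + w ^+ i *: h)))).
    by apply: ler_sum => i _; rewrite nrmZ nrmCV nrmCX w1 expr1n invr1 mul1r.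
  rewrite ler_peMl ?sumr_ge0// => [i _|]; first exact: nrm_ge0.
  by rewrite ler1n (ltn_trans _ N1).
have B0 : 0 <= B := le_trans (nrm_ge0 _) (HB 0%N).
apply/eqP; rewrite -subr_eq0; apply/eqP; apply: nrm0P.
apply/ler_addgt0Pr => /= eps eps0; rewrite add0r.
have n1 : 0 < nrm h + 1 by rewrite ltr_wpDl ?nrm_ge0.
have e2 : 0 < eps / 2 / (nrm h + 1) by rewrite !divr_gt0.
have [d d0 Hd] := diff_hasD dq e2.
(* The three caps make the higher coefficients summable, put [s h] within reach of
   differentiability, and bring the quadratic remainder [2 * B * s^2] below [s * eps / 2]. *)
pose s := Num.min (2^-1) (Num.min (d / 2 / (nrm h + 1)) (eps / 2 / (2 * B + 1))).
have B1 : 0 < 2 * B + 1 by lra.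
have s0 : 0 < s by rewrite !lt_min invr_gt0 ltr0n !divr_gt0.
have [s2 [sd sB]] : s <= 2^-1 /\ s <= d / 2 / (nrm h + 1) /\ s <= eps / 2 / (2 * B + 1).
  by have := lexx s; rewrite {2}/s !le_min => /andP[-> /andP[-> ->]].
have ns : nrm (s%:C : R[i]^o) = s by rewrite nrmC_real ger0_norm// ltW.
have sh : nrm (s%:C *: h) = s * nrm h by rewrite nrmZ ns.
have := Hd (s%:C *: h); rewrite sh => /(_ _)H.
have {H} : nrm (q (x + s%:C *: h) - q x - frechet q x (s%:C *: h)) <=
   eps / 2 / (nrm h + 1) * (s * nrm h).
  apply: H; move: sd; rewrite ler_pdivlMr// => sd; nra.
have -> : frechet q x (s%:C *: h) = s%:C *: frechet q x h by exact: linearZ.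
rewrite (line_expansion N1 w1 qE).
set c := fcoef _ _ _ 1 _ _; set r := \sum_(_ < N.-2) _ => H.
have Hr : nrm r <= 2 * B * s ^+ 2.
  by rewrite -ns; apply: (@line_remainder _ (fun j => fcoef N w q j.+2 x h)); rewrite ?ns.
have E : s * nrm (frechet q x h - c) <= eps / 2 / (nrm h + 1) * (s * nrm h) + 2 * B * s ^+ 2.
  rewrite -nrmZr ?(ltW s0)// scalerBr.
  have -> : s%:C *: frechet q x h - s%:C *: c =
    r - (q x + s%:C *: c + r - q x - s%:C *: frechet q x h).
    rewrite [X in _ - (X - _)]addrAC (addrC (q x)) addrK opprB addrCA.
    by rewrite (addrC (s%:C *: c)) opprD (addrA r) subrr sub0r.
  by rewrite (le_trans (nrmB _ _))// addrC lerD.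
have E1 : eps / 2 / (nrm h + 1) * nrm h <= eps / 2.
  rewrite mulrAC ler_pdivrMr// ler_wpM2l ?lerDl// divr_ge0// ltW//.
have E2 : (2 * B) * s <= eps / 2.
  move: sB; rewrite ler_pdivlMr//; have := ltW s0; lra.
rewrite -(ler_pM2l s0) (le_trans E)//.
move: (ler_wpM2l (ltW s0) E1) (ler_wpM2l (ltW s0) E2); lra.
Qed.

(** Both sides are double averages of [q (x + w^i b + w^j a)] with the symmetric weight [c i * c j];
    exchanging the sums swaps [a] and [b]. *)
Lemma frechet_sym Y (q : X -> Y) x h l : line_poly q ->
  (forall x, differentiable q x) -> differentiable (frechet q) x ->
  frechet (frechet q) x h l = frechet (frechet q) x l h.
Proof.
move=> [N [w [N1 w1 qE]]] dq ddq.
pose c i := w ^- (i * 1).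
have D2 a b : frechet (frechet q) x a b =
   N%:R^-1 *: \sum_(i < N) c i *: (N%:R^-1 *: \sum_(j < N) c j *:
      q (x + w ^+ i *: b + w ^+ j *: a)).
  have [L HL <-] : exists2 L, hasD (fun y => frechet q y b) x L &
      L a = frechet (frechet q) x a b.
    have [L HL LE] := hasD_app a (diff_hasD ddq) (hasD_cst b x).
    by exists L => //; rewrite LE linear0 addr0.
  have HL' : hasD (fun y => frechet q y b) x
     (N%:R^-1 *: \sum_(i < N) c i *: frechet q (x + w ^+ i *: b)).
    have -> : (fun y => frechet q y b) = (fun y => fcoef N w q 1 y b).
      by apply/funext => y; rewrite (frechet_fcoef _ N1 w1 qE).
    apply: hasDZ; apply: hasD_sum => i; apply: hasDZ; apply: hasD_shift.
    exact: diff_hasD.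
  rewrite (hasD_unique HL HL') blinZE blin_sumE; congr (_ *: _).
  by apply: eq_bigr => i _; rewrite blinZE (frechet_fcoef _ N1 w1 qE).
rewrite !D2; congr (_ *: _).
under eq_bigr do rewrite scalerA scaler_sumr.
under [RHS]eq_bigr do rewrite scalerA scaler_sumr.
rewrite exchange_big /=; apply: eq_bigr => i _; apply: eq_bigr => j _.
by rewrite !scalerA [c j * _]mulrC -!mulrA [c j * _]mulrC addrAC [X in X *: _]mulrCA.
Qed.

End LinePolynomials.

(** * Termwise differentiation *)

Section Termwise.
Context (R : realType) (X : normedModType R[i]).
Implicit Types Y : normedModType R[i].

Lemma fcoef_ball Y N w (q : X -> Y) (r B : R) j x h : (0 < N)%N ->
  nrm (w : R[i]^o) = 1 -> (forall x, nrm x <= r -> nrm (q x) <= B) ->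
  nrm x <= r / 2 -> nrm h <= r / 2 -> nrm (fcoef N w q j x h) <= B.
Proof.
move=> N0 w1 qB xr hr; apply: fcoef_le => // i; apply: qB.
rewrite (le_trans (nrmD _ _))// nrmZ nrmCX w1 expr1n mul1r; lra.
Qed.

(** For [x] and [h] of norm at most [r / 2] the sample points [x + w^i h] stay in the ball of radius
    [r]; rescaling [h] to length [r / 2] produces the factor [2 / r]. *)
Lemma frechet_ball Y (q : X -> Y) (r B : R) x : 0 < r -> line_poly q ->
  (forall x, nrm x <= r -> nrm (q x) <= B) -> differentiable q x ->
  nrm x <= r / 2 -> nrm (frechet q x) <= 2 * B / r.
Proof.
move=> r0 [N [w [N1 w1 qE]]] qB dq xr.
have B0 : 0 <= B.
  apply: le_trans (nrm_ge0 (q 0)) (qB 0 _); by rewrite nrm0 ltW.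
apply: blin_nrm_le => [|h]; first by rewrite divr_ge0 ?mulr_ge0// ltW.
have [->|h0] := eqVneq h 0; first by rewrite linear0 !nrm0 mulr0.
have nh := nrm_gt0 h0.
have c0 : 0 <= r / 2 / nrm h by rewrite !divr_ge0 ?nrm_ge0// ltW.
have := @fcoef_ball _ N w q r B 1 x ((r / 2 / nrm h)%:C *: h) (ltnW N1) w1 qB xr.
rewrite nrmZr// -mulrA mulVf ?gt_eqF// mulr1 => /(_ (lexx _)).
rewrite -(frechet_fcoef _ N1 w1 qE dq) linearZ /= nrmZr//.
rewrite mulrAC ler_pdivrMr// mulrAC ler_pdivrMr// => H.
rewrite mulrAC ler_pdivlMr//; lra.
Qed.

Lemma remainder_ball Y (q : X -> Y) (r B : R) x h : 0 < r -> line_poly q ->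
  (forall x, nrm x <= r -> nrm (q x) <= B) -> differentiable q x ->
  nrm x <= r / 2 -> nrm h <= r / 4 ->
  nrm (q (x + h) - q x - frechet q x h) <= 8 * B / r ^+ 2 * nrm h ^+ 2.
Proof.
move=> r0 [N [w [N1 w1 qE]]] qB dq xr hr.
have [->|h0] := eqVneq h 0.
  by rewrite addr0 subrr linear0 subr0 !nrm0 expr0n mulr0.
have nh := nrm_gt0 h0.
(* Normalized so that [nrm u = r / 2] and [t <= 1/2]: the coefficients along [u] are bounded by [B],
   and [2 * B * t^2] is the stated bound. *)
pose t := nrm h / (r / 2); pose u := t^-1%:C *: h.
have t0 : 0 < t by rewrite !divr_gt0.
have nu : nrm u = r / 2.
  by rewrite nrmZr ?invr_ge0 ?(ltW t0)// /t invf_div divfK// gt_eqF.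
have hE : h = t%:C *: u.
  by rewrite /u scalerA -rmorphM /= divff ?gt_eqF// rmorph1 scale1r.
have nt : nrm (t%:C : R[i]^o) = t by rewrite nrmC_real ger0_norm// ltW.
rewrite {1 2}hE (line_expansion N1 w1 qE).
have -> : frechet q x (t%:C *: u) = t%:C *: frechet q x u by exact: linearZ.
rewrite (frechet_fcoef _ N1 w1 qE dq).
rewrite -[X in nrm X]addrA -opprD [X in nrm X]addrAC subrr add0r.
have := @line_remainder _ _ (fun j => fcoef N w q j.+2 x u) N.-2 B t%:C 2.
rewrite nt => /(_ _ _)H; apply: le_trans (H _ _) _.
- by rewrite /t ler_pdivrMr ?divr_gt0//; lra.
- move=> j; apply: fcoef_ball qB _ _ => //; first exact: ltnW.
  by rewrite nu.
rewrite /t expr_div_n expr_div_n invf_div.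
suff -> : 2 * B * (nrm h ^+ 2 * (2 ^+ 2 / r ^+ 2)) = 8 * B / r ^+ 2 * nrm h ^+ 2 by [].
by ring.
Qed.

(** The derivatives of the terms sum geometrically in operator norm to a candidate [S]. Summing the
    quadratic remainders of the terms bounds that of [F], and the geometric sum doubles 8 to 16. *)
Lemma termwise_frechet Y (gY : geometric_complete Y) (q : nat -> X -> Y)
    (F : X -> Y) (r M : R) :
  0 < r -> (forall k, line_poly (q k)) -> (forall k x, differentiable (q k) x) ->
  (forall k x, nrm x <= r -> nrm (q k x) <= M * 2^-1 ^+ k) ->
  (forall x, nrm x <= r -> series (q^~ x) @ \oo --> F x) ->
  forall x, nrm x <= r / 2 ->
  [/\ hasD F x (frechet F x),
      series (fun k => frechet (q k) x) @ \oo --> frechet F x &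
      forall h, nrm h <= r / 4 ->
        nrm (F (x + h) - F x - frechet F x h) <= 16 * M / r ^+ 2 * nrm h ^+ 2].
Proof.
move=> r0 lq dq qM qF x xr.
have fM k : nrm (frechet (q k) x) <= 2 * M / r * 2^-1 ^+ k.
  have -> : 2 * M / r * 2^-1 ^+ k = 2 * (M * 2^-1 ^+ k) / r by ring.
  by apply: frechet_ball => // y; exact: qM.
have [S HS] := blin_geometric gY fM.
have rem h : nrm h <= r / 4 ->
    nrm (F (x + h) - F x - S h) <= 16 * M / r ^+ 2 * nrm h ^+ 2.
  move=> hr; pose v k := q k (x + h) - q k x - frechet (q k) x h.
  have vM k : nrm (v k) <= (8 * M / r ^+ 2 * nrm h ^+ 2) * 2^-1 ^+ k.
    have -> : 8 * M / r ^+ 2 * nrm h ^+ 2 * 2^-1 ^+ k =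
              8 * (M * 2^-1 ^+ k) / r ^+ 2 * nrm h ^+ 2 by ring.
    by apply: remainder_ball => // y; exact: qM.
  have vF : series v @ \oo --> F (x + h) - F x - S h.
    have -> : series v = (fun n => series (fun k => q k (x + h)) n
        - series (fun k => q k x) n - series (fun k => frechet (q k) x h) n).
      by apply/funext => n; rewrite /series /= !sumrB.
    apply: cvgB; last exact: series_app.
    apply: cvgB; apply: qF; last lra.
    by rewrite (le_trans (nrmD _ _))//; lra.
  have -> : 16 * M / r ^+ 2 * nrm h ^+ 2 = 2 * (8 * M / r ^+ 2 * nrm h ^+ 2) by ring.
  exact: series_lim_bound vM vF.
have M0 : 0 <= M.
  have := qM 0%N 0; rewrite nrm0 expr0 mulr1 => /(_ (ltW r0)).
  exact: le_trans (nrm_ge0 _).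
have HF : hasD F x S.
  have C0 : 0 <= 16 * M / r ^+ 2 by apply: divr_ge0; [exact: mulr_ge0|exact: sqr_ge0].
  have r4 : 0 < r / 4 by rewrite divr_gt0.
  by apply/hasD_small; apply: (small_le r4 _ (small_sq X C0)) => h /ltW; exact: rem.
by rewrite (hasD_frechet HF).
Qed.

Lemma nrm_ball_open (r : R) : open [set x : X | nrm x < r].
Proof.
rewrite openE => x /= xr; apply/nbhs_nrmP; exists (r - nrm x).
  by rewrite subr_gt0.
move=> y yx; have -> : y = (y - x) + x by rewrite subrK.
by rewrite /= (le_lt_trans (nrmD _ _))// -ltrBrDr.
Qed.

(** The maps [frechet (q k)] satisfy the same hypotheses with codomain [blin X Y], radius [r / 2]
    and constant [2 * M / r], so the induction on [m] runs over all codomains. *)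
Lemma termwise_smooth m Y (gY : geometric_complete Y) (q : nat -> X -> Y)
    (F : X -> Y) (r M : R) :
  0 < r -> (forall k, line_poly (q k)) -> (forall k m, smooth m setT (q k)) ->
  (forall k x, nrm x <= r -> nrm (q k x) <= M * 2^-1 ^+ k) ->
  (forall x, nrm x <= r -> series (q^~ x) @ \oo --> F x) ->
  exists2 r' : R, 0 < r' & smooth m [set x | nrm x < r'] F.
Proof.
elim: m Y gY q F r M => [|m IH] Y gY q F r M r0 lq sq qM qF; first by exists r.
have dq k x : differentiable (q k) x by have [H _] := sq k 1%N; exact: H.
have r2 : 0 < r / 2 by rewrite divr_gt0.
have T := termwise_frechet gY r0 lq dq qM qF.
have [|k m'|k x xr|x xr|r' r'0 sF] := IH _ (blin_geometric gY)
  (fun k => frechet (q k)) (frechet F) (r / 2) (2 * M / r) r2.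
- by move=> k; exact: line_poly_frechet.
- by have [] := sq k m'.+1.
- have -> : 2 * M / r * 2^-1 ^+ k = 2 * (M * 2^-1 ^+ k) / r by ring.
  by apply: frechet_ball => // y; exact: qM.
- by have [] := T _ xr.
exists (Num.min r' (r / 2)); first by rewrite lt_min r'0.
split=> [x|].
  by rewrite /= lt_min => /andP[_ /ltW /T[/hasD_diff]].
by apply: smooth_sub sF => x; rewrite /= lt_min => /andP[].
Qed.

Lemma termwise_sym Y (gY : geometric_complete Y) (q : nat -> X -> Y)
    (F : X -> Y) (r M : R) h l :
  0 < r -> (forall k, line_poly (q k)) -> (forall k m, smooth m setT (q k)) ->
  (forall k x, nrm x <= r -> nrm (q k x) <= M * 2^-1 ^+ k) ->
  (forall x, nrm x <= r -> series (q^~ x) @ \oo --> F x) ->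
  frechet (frechet F) 0 h l = frechet (frechet F) 0 l h.
Proof.
move=> r0 lq sq qM qF.
have dq k x : differentiable (q k) x by have [H _] := sq k 1%N; exact: H.
have ddq k x : differentiable (frechet (q k)) x by have [_ [H _]] := sq k 2; exact: H.
have r2 : 0 < r / 2 by rewrite divr_gt0.
have T := termwise_frechet gY r0 lq dq qM qF.
have lq' k : line_poly (frechet (q k)) by exact: line_poly_frechet.
have qM' k x : nrm x <= r / 2 ->
    nrm (frechet (q k) x) <= 2 * M / r * 2^-1 ^+ k.
  move=> xr; have -> : 2 * M / r * 2^-1 ^+ k = 2 * (M * 2^-1 ^+ k) / r by ring.
  by apply: frechet_ball => // y; exact: qM.
have qF' x : nrm x <= r / 2 ->
    series (fun k => frechet (q k) x) @ \oo --> frechet F x.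
  by move=> /T[].
have x0 : nrm (0 : X) <= r / 2 / 2 by rewrite nrm0 !divr_ge0// ltW.
have [] := termwise_frechet (blin_geometric gY) r2 lq' ddq qM' qF' x0.
move=> _ /series_app S2 _.
have A := series_app (x := l) (S2 h); have B := series_app (x := h) (S2 l).
apply: lim_uniq A _.
by under eq_fun do rewrite (frechet_sym _ _ (lq _) (dq _) (ddq _ _)).
Qed.

End Termwise.

(** * Taylor series of normalized mappings *)

Section HomogeneousForms.
Context (R : realType) (X : normedModType R[i]).
Implicit Types Y : normedModType R[i].

Lemma smooth_mdiag k m Y (u : X -> mlin X Y k) :
  smooth m setT u -> smooth m setT (fun x => mdiag (u x) x).
Proof.
elim: k u => [|k IH] u su //=; apply: IH.
apply: (smooth_bil openT (@bapp_bbilin _ X (mlin X Y k)) su).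
by apply: smooth_id; exact: openT.
Qed.

Lemma mdiagZ k Y (A : mlin X Y k) (a : R[i]) x : mdiag (a *: A) x = a *: mdiag A x.
Proof. by elim: k A => [|k IH] A //=; rewrite -IH. Qed.

Lemma mdiag_scale k Y (A : mlin X Y k) (t : R[i]) x :
  mdiag A (t *: x) = t ^+ k *: mdiag A x.
Proof.
elim: k A => [|k IH] A /=; first by rewrite expr0 scale1r.
by rewrite IH linearZ /= mdiagZ scalerA -exprSr.
Qed.

Lemma mdiag_line k Y (u : R[i] -> mlin X Y k) x h N (a : nat -> mlin X Y k) :
  (forall t, u t = \sum_(j < N) t ^+ j *: a j) ->
  exists b : nat -> Y,
    forall t, mdiag (u t) (x + t *: h) = \sum_(j < N + k) t ^+ j *: b j.
Proof.
elim: k N u a => [|k IH] N u a uE; first by exists a => t; rewrite addn0 -uE.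
(* Coefficients of [u t (x + t h)]: [a j x + a (j - 1) h], out-of-range terms being 0. Each filled
   slot raises the number of coefficients by one. *)
pose b j : mlin X Y k := (if (j < N)%N then (a j : blin X (mlin X Y k)) x else 0) +
  (if j is j'.+1 then (a j' : blin X (mlin X Y k)) h else 0).
have [t|c cE] := IH N.+1 (fun t => (u t : blin X (mlin X Y k)) (x + t *: h)) b.
  rewrite uE blin_sumE.
  under [RHS]eq_bigr do rewrite scalerDr.
  rewrite big_split /= big_ord_recr /= ltnn scaler0 addr0.
  rewrite [X in _ = _ + X]big_ord_recl /= scaler0 add0r -big_split /=.
  apply: eq_bigr => j _; rewrite ltn_ord /bump add1n.
  have aD : (a j : blin X (mlin X Y k)) (x + t *: h) = (a j : blin _ _) x +
      t *: (a j : blin _ _) h by rewrite linearD; congr (_ + _); exact: linearZ.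
  transitivity (t ^+ j *: (a j : blin X (mlin X Y k)) (x + t *: h)); first by [].
  by rewrite aD scalerDr scalerA -exprSr.
by exists c => t; rewrite addnS -addSn -cE.
Qed.

Definition homogeneous_form k Y (q : X -> Y) :=
  exists (c : R[i]) (A : mlin X Y k), forall x, q x = c *: mdiag A x.

Lemma form_scale k Y (q : X -> Y) t x : homogeneous_form k q ->
  q (t *: x) = t ^+ k *: q x.
Proof. by move=> [c [A qE]]; rewrite !qE mdiag_scale !scalerA mulrC. Qed.

Lemma form_smooth k Y (q : X -> Y) m : homogeneous_form k q -> smooth m setT q.
Proof.
move=> [c [A qE]]; have -> : q = fun x => mdiag (c *: A) x.
  by apply/funext => x; rewrite qE mdiagZ.
apply: (@smooth_mdiag k m Y (fun=> c *: A)).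
by apply: smooth_cst; exact: openT.
Qed.

Lemma form_line k Y (q : X -> Y) : homogeneous_form k q -> line_poly q.
Proof.
move=> [c [A qE]]; apply: line_poly_coef; exists (1 + k)%N => x h.
have [t|b bE] := @mdiag_line k Y (fun=> c *: A) x h 1 (fun=> c *: A).
  by rewrite big_ord1 expr0 scale1r.
by exists b => t; rewrite qE -mdiagZ bE.
Qed.

(** Degrees 0 and 1 are set to [0] and [x], as in the assumed series; that [f 0 = 0] and that the
    derivative at 0 is the identity are only derived from it later. *)
Definition taylor_term (f : X -> X) (k : nat) (x : X) : X :=
  if (1 < k)%N then homog f k x else if k == 1%N then x else 0.

Lemma taylor_term_form f k : homogeneous_form k (taylor_term f k).
Proof.
rewrite /taylor_term; case: k => [|[|k]] /=.
- by exists 0, 0 => x; rewrite scale0r.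
- by exists 1, (blin_id X) => x; rewrite scale1r.
- by exists (k.+2`!%:R)^-1, (Dn f k.+2 0).
Qed.

Lemma taylor_term_ge2 f k x : (1 < k)%N -> taylor_term f k x = homog f k x.
Proof. by rewrite /taylor_term => ->. Qed.

Lemma taylor_series (f : X -> X) (x l : X) :
  (fun N => x + \sum_(2 <= k < N) homog f k x) @ \oo --> l ->
  series (taylor_term f ^~ x) @ \oo --> l.
Proof.
apply: cvg_trans; apply: near_eq_cvg; exists 2 => // -[|[|N]] //= _.
rewrite /series /= !big_add1 /= [\sum_(0 <= _ < N.+2) _]big_nat_recl//.
by rewrite [\sum_(0 <= _ < N.+1) _]big_nat_recl//= {1 2}/taylor_term /= add0r.
Qed.

End HomogeneousForms.

(** * Cauchy's inequality for power series *)

Section PowerSeriesBound.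
Context (R : realType) (X : normedModType R[i]).

Lemma cvg_series_bounded (u : nat -> X) (l : X) :
  series u @ \oo --> l -> exists B, forall k, nrm (u k) <= B.
Proof.
move=> /cvg_nrmP/(_ 1 ltr01)[N HN].
exists (2 + \sum_(k < N) nrm (u k)) => k.
have S0 : 0 <= \sum_(k < N) nrm (u k) by rewrite sumr_ge0// => i _; exact: nrm_ge0.
have [kN|Nk] := ltnP k N.
  rewrite (bigD1 (Ordinal kN)) //= addrCA lerDl addr_ge0//.
  by rewrite sumr_ge0// => i _; exact: nrm_ge0.
have H1 := HN _ Nk; have H2 := HN _ (leqW Nk).
have -> : u k = (series u k.+1 - l) - (series u k - l).
  by rewrite opprB addrA subrK /series /= big_nat_recr//= addrC addKr.
by rewrite (le_trans (nrmB _ _))//; lra.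
Qed.

(* Cauchy's inequality: the k-th term is a discrete Fourier coefficient of a
   partial sum, which is close to the bounded sum of the series. *)
Lemma power_series_bound (q : nat -> X -> X) (f : X -> X) (d M : R) :
  (forall k, homogeneous_form k (q k)) -> 0 < d ->
  (forall x, nrm x < d -> nrm (f x) <= M) ->
  (forall x, nrm x < d -> series (q^~ x) @ \oo --> f x) ->
  forall k x, nrm x <= d / 4 -> nrm (q k x) <= M + 1.
Proof.
move=> hq d0 fM qf k x xd.
have x2d : nrm ((2 : R)%:C *: x) < d by rewrite nrmZr//; lra.
(* Convergence at [2 x] bounds the terms there by some [B] depending on [x]; homogeneity turns this
   into decay [2^-j] at [x]. *)
have [B HB] := cvg_series_bounded (qf _ x2d).
have qB j : nrm (q j x) <= B * 2^-1 ^+ j.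
  have := HB j; rewrite (form_scale _ _ (hq j)) nrmZ nrmCX nrmC_real ger0_norm//.
  by rewrite exprVn ler_pdivlMr ?exprn_gt0// mulrC.
have [m Hm] := @half_exp_small R (2 * B) 1 ltr01.
(* [L] depends on [x] through [B], but the resulting tail bound 1 and thus the final bound [M + 1]
   do not. *)
pose L := maxn m k.+1.
have kL : (k < L)%N by rewrite leq_maxr.
have HL : 2 * B * 2^-1 ^+ L <= 1.
  rewrite (le_trans _ (ltW Hm))// ler_wpM2l//.
    by rewrite mulr_ge0// (le_trans (nrm_ge0 _) (HB 0%N)).
  apply: ler_wiXn2l; rewrite ?invr_ge0 ?invf_le1 ?ler1n//.
  exact: leq_maxl.
have [w pw] := @prim_root_ex R L (leq_ltn_trans (leq0n _) kL).
have w1 := prim_root_nrm pw.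
have pE t : series (q^~ (t *: x)) L = \sum_(j < L) t ^+ j *: q j x.
  rewrite /series /= big_mkord; apply: eq_bigr => j _.
  by rewrite (form_scale _ _ (hq j)).
have /= <- := dft (a := fun j => q j x) pw kL pE.
rewrite nrmZ nrmCV nrmC_nat.
rewrite ler_pdivrMl ?ltr0n ?(leq_ltn_trans _ kL)// (le_trans (nrm_sum _ _ _))//.
apply: (@le_trans _ _ (\sum_(i < L) (M + 1))); last first.
  by rewrite sumr_const card_ord mulr_natl.
apply: ler_sum => i _; rewrite nrmZ nrmCV nrmCX w1 expr1n invr1 mul1r.
have nwx : nrm (w ^+ i *: x) = nrm x by rewrite nrmZ nrmCX w1 expr1n mul1r.
have wxd : nrm (w ^+ i *: x) < d by rewrite nwx; lra.
have tail : nrm (f (w ^+ i *: x) - series (q^~ (w ^+ i *: x)) L) <= 2 * B * 2^-1 ^+ L.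
  apply: series_lim_tail (qf _ wxd) => j.
  by rewrite (form_scale _ _ (hq j)) nrmZ !nrmCX w1 !expr1n mul1r.
have -> : series (q^~ (w ^+ i *: x)) L =
  f (w ^+ i *: x) - (f (w ^+ i *: x) - series (q^~ (w ^+ i *: x)) L).
  by rewrite opprB addrC subrK.
rewrite (le_trans (nrmB _ _))// lerD ?fM//.
exact: le_trans tail HL.
Qed.

End PowerSeriesBound.

Section NormalizedMappings.
Context (R : realType) (X : completeNormedModType R[i]).
Variable f : X -> X.
Hypothesis hf : normalized_holomorphic f.

Lemma normalized_bound : exists r M : R,
  [/\ 0 < r, 0 <= M,
    forall k x, nrm x <= r -> nrm (taylor_term f k x) <= M * 2^-1 ^+ k &
    forall x, nrm x <= r -> series (taylor_term f ^~ x) @ \oo --> f x].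
Proof.
have [/nbhs_singleton df /near0_nrmP[d d0 fd]] := hf.
have /differentiable_continuous/continuous_nrmP/(_ 1 ltr01)[d' d'0 fd'] := df.
pose D := Num.min d d'.
have D0 : 0 < D by rewrite lt_min d0.
have fM x : nrm x < D -> nrm (f x) <= nrm (f 0) + 1.
  rewrite lt_min => /andP[_ xd]; have := fd' x; rewrite subr0 => /(_ xd)/ltW H.
  have -> : f x = f 0 + (f x - f 0) by rewrite addrC subrK.
  by rewrite (le_trans (nrmD _ _))// lerD2l.
have fS x : nrm x < D -> series (taylor_term f ^~ x) @ \oo --> f x.
  by rewrite lt_min => /andP[/fd H _]; exact: taylor_series.
have H := power_series_bound (@taylor_term_form _ _ f) D0 fM fS.
(* The Cauchy bound holds up to [D / 4]; halving the radius gives the decay [2^-k] by homogeneity.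
   One summand 1 comes from continuity of [f] at 0, the other from [power_series_bound]. *)
exists (D / 8), (nrm (f 0) + 1 + 1); split.
- by rewrite divr_gt0.
- by rewrite !addr_ge0 ?nrm_ge0.
- move=> k x xD.
  have -> : x = (2^-1 : R)%:C *: ((2 : R)%:C *: x).
    by rewrite scalerA -rmorphM /= mulVf// rmorph1 scale1r.
  rewrite (form_scale _ _ (@taylor_term_form _ _ f k)) nrmZ nrmCX nrmC_real.
  rewrite ger0_norm ?invr_ge0// mulrC ler_wpM2r ?exprn_ge0 ?invr_ge0//.
  by apply: H; rewrite nrmZr//; lra.
- by move=> x xD; apply: fS; lra.
Qed.

(** All terms of index [k >= m] carry [t^k], and [|t|^k <= |t|^m]; the remaining series is
    geometric. *)
Lemma normalized_taylor : exists r M : R,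
  [/\ 0 < r, 0 <= M &
    forall x t m, nrm x <= r -> nrm (t : R[i]^o) <= 1 ->
      nrm (f (t *: x) - \sum_(k < m) t ^+ k *: taylor_term f k x) <=
        M * nrm (t : R[i]^o) ^+ m].
Proof.
have [r [M [r0 M0 qM qf]]] := normalized_bound; exists r, (2 * M).
split => //; first exact: mulr_ge0.
move=> x t m xr t1.
pose u k := if (k < m)%N then 0 else t ^+ k *: taylor_term f k x.
have txr : nrm (t *: x) <= r.
  by rewrite nrmZ (le_trans _ xr)// ler_piMl ?nrm_ge0.
have uM k : nrm (u k) <= (M * nrm (t : R[i]^o) ^+ m) * 2^-1 ^+ k.
  rewrite /u; case: ltnP => mk.
    by rewrite nrm0 !mulr_ge0 ?exprn_ge0 ?nrm_ge0 ?invr_ge0.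
  rewrite nrmZ nrmCX mulrAC mulrC ler_pM ?nrm_ge0 ?exprn_ge0 ?nrm_ge0// ?qM//.
  by rewrite ler_wiXn2l ?nrm_ge0.
rewrite -mulrA; apply: series_lim_bound uM _.
have H : series (taylor_term f ^~ (t *: x)) @ \oo --> f (t *: x) by exact: qf.
have : (fun n => series (taylor_term f ^~ (t *: x)) n
         - \sum_(k < m) t ^+ k *: taylor_term f k x) @ \oo -->
       f (t *: x) - \sum_(k < m) t ^+ k *: taylor_term f k x.
  by apply: cvgB => //; exact: cvg_cst.
apply: cvg_trans; apply: near_eq_cvg; exists m => // n /= mn; symmetry.
rewrite /series /= (big_cat_nat (leq0n m) mn)/=.
have -> : \sum_(0 <= k < m) u k = 0.
  by rewrite big_nat big1// => k /andP[_ km]; rewrite /u km.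
rewrite add0r.
rewrite [in RHS](big_cat_nat (leq0n m) mn)/= big_mkord.
rewrite [X in X + _ - _](eq_bigr (fun k : 'I_m => t ^+ k *: taylor_term f k x)).
  rewrite addrAC subrr add0r; apply: eq_big_nat => k /andP[mk _].
  by rewrite /u ltnNge mk /= (form_scale _ _ (@taylor_term_form _ _ f k)).
by move=> k _; rewrite (form_scale _ _ (@taylor_term_form _ _ f k)).
Qed.

Lemma normalized0 : f 0 = 0.
Proof.
have [r [M [r0 M0 H]]] := normalized_taylor.
have := H 0 0 1%N; rewrite nrm0 scale0r big_ord1 expr0 scale1r /taylor_term /=.
rewrite nrm0 subr0 expr1 mulr0 => /(_ (ltW r0) ler01) H0.
exact: nrm0P.
Qed.

Lemma normalized_hasD0 : hasD f 0 (blin_id X).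
Proof.
have [r [M [r0 M0 H]]] := normalized_taylor.
have C0 : 0 <= M / r ^+ 2 by rewrite divr_ge0// sqr_ge0.
apply/hasD_small; apply: (small_le r0 _ (small_sq X C0)) => h /ltW hr.
rewrite add0r normalized0 subr0.
have [->|h0] := eqVneq h 0; first by rewrite normalized0 subr0 !nrm0 expr0n mulr0.
have nh := nrm_gt0 h0.
pose t := nrm h / r; have t0 : 0 < t by rewrite divr_gt0.
have nt : nrm (t%:C : R[i]^o) = t by rewrite nrmC_real ger0_norm// ltW.
have hE : h = t%:C *: (t^-1%:C *: h).
  by rewrite scalerA -rmorphM /= divff ?gt_eqF// rmorph1 scale1r.
have nv : nrm (t^-1%:C *: h) = r.
  by rewrite nrmZr ?invr_ge0 ?(ltW t0)// /t invf_div divfK// gt_eqF.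
have t1 : t <= 1 by rewrite /t ler_pdivrMr// mul1r.
have := H (t^-1%:C *: h) t%:C 2; rewrite nv nt => /(_ (lexx _) t1).
rewrite big_ord_recl big_ord1 /taylor_term /= scaler0 add0r expr1 -hE.
rewrite /t expr_div_n.
by have -> : M * (nrm h ^+ 2 / r ^+ 2) = M / r ^+ 2 * nrm h ^+ 2 by ring.
Qed.

Lemma normalized_smooth m : exists2 r : R, 0 < r & smooth m [set x | nrm x < r] f.
Proof.
have [r [M [r0 M0 qM qf]]] := normalized_bound.
apply: (termwise_smooth m (@complete_geometric _ X) r0 _ _ qM qf).
- by move=> k; apply: form_line; exact: taylor_term_form.
- by move=> k n; apply: form_smooth; exact: taylor_term_form.
Qed.

Lemma normalized_sym h l : D2at0 f h l = D2at0 f l h.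
Proof.
have [r [M [r0 M0 qM qf]]] := normalized_bound.
have -> : D2at0 f = frechet (frechet f) 0 by [].
have lq k : line_poly (taylor_term f k) := form_line (taylor_term_form f k).
have sq k n : smooth n setT (taylor_term f k).
  exact: form_smooth (taylor_term_form f k).
exact: (termwise_sym (@complete_geometric _ X) h l r0 lq sq qM qf).
Qed.

(** Uniformity in the base point [x] is what the local inverse requires, since it is differentiated
    at all points near 0. *)
Lemma normalized_remainder : exists r K : R, [/\ 0 < r, 0 <= K &
  forall x h, nrm x <= r -> nrm h <= r ->
    nrm (f (x + h) - f x - frechet f x h) <= K * nrm h ^+ 2].
Proof.
have [r [M [r0 M0 qM qf]]] := normalized_bound.
exists (r / 4), (16 * M / r ^+ 2); split; first by rewrite divr_gt0.
  by apply: divr_ge0; [exact: mulr_ge0|exact: sqr_ge0].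
move=> x h xr; have xr2 : nrm x <= r / 2 by lra.
have lq k : line_poly (taylor_term f k) := form_line (taylor_term_form f k).
have dq k y : differentiable (taylor_term f k) y.
  by have [+ _] := form_smooth 1 (taylor_term_form f k); exact.
by have [_ _] := termwise_frechet (@complete_geometric _ X) r0 lq dq qM qf xr2; exact.
Qed.

End NormalizedMappings.

(** * Composition of germs *)

Section Germs.
Context (R : realType) (X : normedModType R[i]).
Implicit Types f g : X -> X.

Definition D3at0 f : blin X (blin X (blin X X)) := Dn f 3 0.

(** Order three is what [Psi] reads off, and the class is stable under composition with no reference
    to Taylor series. *)
Definition tangent_germ f := [/\ f 0 = 0, frechet f 0 = blin_id X &
  exists2 r : R, 0 < r & smooth 3 [set x | nrm x < r] f].

Lemma hasD_eval (Y Z : normedModType R[i]) (V : Y -> blin Y Z) x a :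
  differentiable V x ->
  exists2 L, hasD (fun y => V y a) x L & forall h, L h = frechet V x h a.
Proof.
move=> dV; eexists.
  exact: (hasD_bil (@bapp_bbilin _ Y Z) (diff_hasD dV) (hasD_cst a x)).
by move=> h; rewrite blinDE /= linear0 addr0.
Qed.

(** The two orders of the slots in [D2at0 f] are kept apart, because symmetry is established for
    normalized mappings and not for tangent germs; callers merge them by [normalized_sym]. *)
Lemma germ_comp f g : tangent_germ f -> tangent_germ g ->
  [/\ tangent_germ (f \o g),
      forall h k, D2at0 (f \o g) h k = D2at0 f h k + D2at0 g h k &
      forall e, D3at0 (f \o g) e e e = D3at0 f e e e + D3at0 g e e e +
        D2at0 f (D2at0 g e e) e + 2 *: D2at0 f e (D2at0 g e e)].
Proof.
move=> [f0 f1 [rf rf0 sf]] [g0 g1 [rg rg0 sg]].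
have sf' := sf; have sg' := sg.
case: sf' => df [dff [dfff _]]; case: sg' => dg [dgg [dggg _]].
have [d d0 Hd] : exists2 d : R, 0 < d & forall x, nrm x < d -> nrm (g x) < rf.
  have g0D : [set x | nrm x < rg] (0 : X) by rewrite /= nrm0.
  have [d d0 Hd] := (continuous_nrmP _ _).1 (hasD_cont (diff_hasD (dg _ g0D))) _ rf0.
  by exists d => // x xd; have := Hd x; rewrite g0 !subr0; exact.
pose D := [set x : X | nrm x < Num.min d rg].
have D0 : D 0 by rewrite /D /= nrm0 lt_min d0.
have oD : open D := @nrm_ball_open R X _.
have Dg x : D x -> nrm x < rg by rewrite /D /= lt_min => /andP[].
have Df x : D x -> nrm (g x) < rf by rewrite /D /= lt_min => /andP[/Hd].
have near_D x : D x -> \forall y \near x, D y.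
  by move=> Dx; exact: open_nbhs_nbhs.
have su : smooth 3 D (f \o g).
  apply: (smooth_comp (@nrm_ball_open R X rf) oD Df sf).
  by apply: smooth_sub sg => x; exact: Dg.
have u1 x : D x -> hasD (f \o g) x (bcomp (frechet f (g x)) (frechet g x)).
  by move=> Dx; apply: hasD_comp; apply: diff_hasD; [exact/df/Df|exact/dg/Dg].
have u2 x : D x -> hasD (frechet (f \o g)) x
    (bil_appl (@bcomp_bbilin _ X X X)
       (bcomp (frechet (frechet f) (g x)) (frechet g x)) (frechet g x) +
     bil_appr (@bcomp_bbilin _ X X X) (frechet f (g x)) (frechet (frechet g) x)).
  move=> Dx; apply: (@hasD_eq _ _ _ (fun y => bcomp (frechet f (g y)) (frechet g y))).
    by apply: filterS (near_D _ Dx) => y /u1/hasD_frechet.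
  apply: hasD_bil; last exact/diff_hasD/dgg/Dg.
  by apply: hasD_comp; apply: diff_hasD; [exact/dff/Df|exact/dg/Dg].
have u2E x h k : D x -> frechet (frechet (f \o g)) x h k =
    frechet (frechet f) (g x) (frechet g x h) (frechet g x k) +
    frechet f (g x) (frechet (frechet g) x h k).
  by move=> /u2/hasD_frechet ->.
split=> [|h k|e].
- split; first by rewrite /= g0.
    by rewrite (hasD_frechet (u1 _ D0)) g0 f1 g1; exact: blin_ext.
  by exists (Num.min d rg); rewrite ?lt_min ?d0.
- have := u2E 0 h k D0; rewrite g0 f1 g1; exact.
have Dgrg : [set x | nrm x < rg] 0 := Dg _ D0.
have g0rf : [set x | nrm x < rf] (g 0) := Df _ D0.
have [_ [_ [duuu _]]] := su.
(* Evaluating at [e] before differentiating again reduces the third derivative to the product rule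
   for vector-valued functions. *)
have [A1 HA1 A1E] := hasD_eval e (duuu _ D0).
have [A2 HA2 A2E] : exists2 L, hasD (fun y => frechet (frechet (f \o g)) y e e) 0 L &
    forall h, L h = D3at0 (f \o g) h e e.
  have [L HL LE] := hasD_eval e (hasD_diff HA1).
  exists L => // h; rewrite LE (hasD_frechet HA1) A1E //.
rewrite -A2E.
have [G1 HG1 G1E] := hasD_eval e (dgg _ Dgrg).
have [G2 HG2 G2E] : exists2 L, hasD (fun y => frechet (frechet g) y e e) 0 L &
    forall h, L h = D3at0 g h e e.
  have [L0 HL0 L0E] := hasD_eval e (dggg _ Dgrg).
  have [L HL LE] := hasD_eval e (hasD_diff HL0).
  by exists L => // h; rewrite LE (hasD_frechet HL0) L0E.
have Hg := diff_hasD (dg _ Dgrg).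
have F1 := hasD_comp (diff_hasD (dff _ g0rf)) Hg.
have F2 := hasD_comp (diff_hasD (dfff _ g0rf)) Hg.
have [B1 HB1 B1E] := hasD_app e F2 HG1.
have [B2 HB2 B2E] := hasD_app e HB1 HG1.
have [B3 HB3 B3E] := hasD_app e F1 HG2.
(* [B2] differentiates [f''(g)(g' e)(g' e)] and [B3] differentiates [f'(g)(g'' e e)]. *)
have HA2' : hasD (fun y => frechet (frechet (f \o g)) y e e) 0 (B2 + B3).
  apply: (@hasD_eq _ _ _ (fun x =>
    frechet (frechet f) (g x) (frechet g x e) (frechet g x e) +
    frechet f (g x) (frechet (frechet g) x e e))); last exact: hasDD HB2 HB3.
  by apply: filterS (near_D _ D0) => y Dy; rewrite u2E.
rewrite (hasD_unique HA2 HA2').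
rewrite blinDE B2E B3E B1E !G1E G2E blinDE g0 g1 f1 scaler_nat mulr2n.
set b := D2at0 f _ e; set c := D2at0 f e _.
transitivity (D3at0 f e e e + b + c + (c + D3at0 g e e e)); first by [].
rewrite (addrC c (D3at0 g e e e)) !addrA; congr (_ + _).
by rewrite addrAC; congr (_ + _); rewrite addrAC.
Qed.

Lemma tangent_germ_id : tangent_germ (fun x : X => x).
Proof.
split => //; first exact: hasD_frechet (hasD_id 0).
by exists 1 => //; apply: smooth_id; exact: nrm_ball_open.
Qed.

Lemma D2at0_id h k : D2at0 (fun x : X => x) h k = 0.
Proof.
have -> : D2at0 (fun x : X => x) = frechet (fun=> blin_id X) 0.
  congr frechet; apply/funext => x; exact: hasD_frechet (hasD_id x).
by rewrite (hasD_frechet (hasD_cst _ _)).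
Qed.

Lemma D3at0_id h k l : D3at0 (fun x : X => x) h k l = 0.
Proof.
have -> : D3at0 (fun x : X => x) = frechet (fun=> 0) 0.
  congr frechet; apply/funext => y.
  have -> : frechet (frechet (fun x : X => x)) y = frechet (fun=> blin_id X) y.
    congr (frechet _ y); apply/funext => x; exact: hasD_frechet (hasD_id x).
  by rewrite (hasD_frechet (hasD_cst _ _)).
by rewrite (hasD_frechet (hasD_cst _ _)).
Qed.

Lemma eq_near0_frechet (Y : normedModType R[i]) (F G : X -> Y) :
  (\forall x \near (0 : X), F x = G x) ->
  (\forall x \near (0 : X), differentiable F x) ->
  \forall x \near (0 : X), frechet F x = frechet G x.
Proof.
move=> /near0_nrmP[d d0 FG] /near0_nrmP[d' d'0 dF]; apply/near0_nrmP.
exists (Num.min d d'); first by rewrite lt_min d0.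
move=> x; rewrite lt_min => /andP[xd xd'].
have /hasD_frechet -> // : hasD G x (frechet F x).
apply: hasD_eq (diff_hasD (dF _ xd')).
have : nbhs x [set y : X | nrm y < d].
  by apply: open_nbhs_nbhs; split => //; exact: nrm_ball_open.
by apply: filterS => y; exact: FG.
Qed.

(** The factorials are cleared once: with [P_2(e) = A / 2], both correction terms acquire
    denominator 4. *)
Lemma PsiE (e : X) (es : dual X) f lam mu : let A := D2at0 f e e in
  Psi e es f lam mu = 6^-1 *: D3at0 f e e e - (mu / 4) *: D2at0 f e A
    - ((lam - mu) / 4 * (es A : R[i])) *: A.
Proof.
move=> A; rewrite /Psi.
have -> : homog f 3 e = 6^-1 *: D3at0 f e e e by [].
have -> : homog f 2 e = 2^-1 *: A by [].
have -> : es (2^-1 *: A) = 2^-1 * (es A : R[i]) by exact: linearZ.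
have -> : D2at0 f e (2^-1 *: A) = 2^-1 *: D2at0 f e A by exact: linearZ.
by rewrite !scalerA; congr (_ - _ *: _ - _ *: _); field.
Qed.

End Germs.

(** * Local inverses *)

Section OperatorInverse.
Context (R : realType).

(** [V] is the sum of the powers of [T = Id - A], and shifting the index gives the right inverse.
    The bound [nrm x <= 2 * nrm (A x)] gives injectivity of [A], hence the left inverse, and
    [nrm V <= 2]. *)
Lemma neumann (X : completeNormedModType R[i]) (A : blin X X) :
  nrm (A - blin_id X) <= 4^-1 ->
  exists V : blin X X, [/\ forall x, A (V x) = x, forall x, V (A x) = x & nrm V <= 2].
Proof.
move=> A4; pose T : blin X X := blin_id X - A.
have T4 : nrm T <= 4^-1 by rewrite /T nrmBC.
have TE k : nrm (blin_exp T k) <= 1 * 2^-1 ^+ k.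
  apply: blin_nrm_le => [|x]; first by rewrite mul1r exprn_ge0 ?invr_ge0.
  rewrite mul1r; elim: k => [|k IH]; first by rewrite expr0 mul1r.
  have -> : blin_exp T k.+1 x = T (blin_exp T k x) by [].
  rewrite exprS (le_trans (blin_nrm _ _))// -mulrA ler_pM ?nrm_ge0//.
  lra.
have [V HV] := blin_geometric (@complete_geometric _ X) TE.
have lower x : nrm x <= 2 * nrm (A x).
  have : nrm x <= nrm (A x) + nrm (T x).
    have {1}-> : x = A x + T x by rewrite /T blinBE addrC subrK.
    exact: nrmD.
  have := le_trans (blin_nrm T x) (ler_wpM2r (nrm_ge0 x) T4).
  have := nrm_ge0 x; lra.
have AV x : A (V x) = x.
  have sV := series_app (x := x) HV.
  have sT := series_blin (T := T) sV.
  suff VE : V x = x + T (V x).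
    have -> : A (V x) = V x - T (V x) by rewrite /T blinBE opprB addrC subrK.
    by rewrite {1}VE addrK.
  apply: (@lim_uniq _ _ (fun n => series (fun k => blin_exp T k x) n.+1)).
    by rewrite (cvg_shiftS (series (fun k => blin_exp T k x))).
  have -> : (fun n => series (fun k => blin_exp T k x) n.+1) =
            (fun n => x + series (fun k => T (blin_exp T k x)) n).
    by apply/funext => n; rewrite /series /= big_nat_recl.
  by apply: cvgD => //; exact: cvg_cst.
exists V; split => //.
- move=> x; apply/eqP; rewrite -subr_eq0; apply/eqP/nrm0P.
  have E : A (V (A x) - x) = 0 by rewrite linearB /= AV subrr.
  by rewrite (le_trans (lower _))// E nrm0 mulr0.
- by apply: blin_nrm_le => // y; have := lower (V y); rewrite AV.
Qed.

Lemma smoothN (X Y : normedModType R[i]) k D (F : X -> Y) : open D ->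
  smooth k D F -> smooth k D (fun x => - F x).
Proof.
move=> oD; elim: k Y F => // k IH Y F sF.
apply: (smooth_hasD (F' := fun x => - frechet F x)) => //; last by apply: IH; case: sF.
move=> x Dx; rewrite -scaleN1r.
have -> : (fun y => - F y) = (fun y => (-1) *: F y).
  by apply/funext => y; rewrite scaleN1r.
exact: hasDZ (smooth_hasDE sF Dx).
Qed.

Variable X : normedModType R[i].

(** The resolvent identity [v(y+k) - v(y) = - v(y+k) (W(y+k) - W(y)) v(y)] first shows that [v] is
    Lipschitz at [y]; inserted back into itself it yields the derivative [- v W' v]. *)
Lemma hasD_inverse (W v : X -> blin X X) (D : set X) (M : R) y : open D -> D y ->
  (forall y x, D y -> W y (v y x) = x) -> (forall y x, D y -> v y (W y x) = x) ->
  (forall y, D y -> nrm (v y) <= M) -> differentiable W y ->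
  hasD v y (- bil_appr (@bcomp_bbilin _ X X X) (v y)
     (bil_appl (@bcomp_bbilin _ X X X) (frechet W y) (v y))).
Proof.
move=> oD Dy Wv vW vM /diff_hasD DW.
have M0 : 0 <= M := le_trans (nrm_ge0 _) (vM _ Dy).
have [d d0 Hd] := hasD_lipschitz DW.
have [d' d'0 Hd'] : exists2 d' : R, 0 < d' & forall k, nrm k < d' -> D (y + k).
  have /nbhs_nrmP[d' d'0 H] : nbhs y D by exact: open_nbhs_nbhs.
  by exists d' => // k kd; apply: H; rewrite addrC addKr.
set c := nrm (frechet W y) + 1 in Hd.
have c0 : 0 <= c by rewrite addr_ge0 ?nrm_ge0.
have C0 : 0 <= M * c * M * c * M by rewrite !mulr_ge0.
have M2 : 0 <= M * M by rewrite mulr_ge0.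
have dd : 0 < Num.min d d' by rewrite lt_min d0.
apply/hasD_small.
apply: (small_le dd _ (smallD (small_sq X C0) (smallM M2 DW))) => k.
rewrite lt_min => /andP[/Hd Hk /Hd' Dk].
pose dW := W (y + k) - W y.
have dv x : v (y + k) x - v y x = - v (y + k) (dW (v y x)).
  by rewrite /dW blinBE Wv// linearB /= vW// opprB.
have ndv x : nrm (v (y + k) x - v y x) <= M * c * nrm k * M * nrm x.
  rewrite dv nrmN (le_trans (blin_nrm _ _))// -!mulrA ler_pM ?nrm_ge0 ?vM//.
  rewrite (le_trans (blin_nrm _ _))// mulrA ler_pM ?nrm_ge0//.
  by rewrite (le_trans (blin_nrm _ _))// ler_wpM2r ?nrm_ge0// vM.
apply: blin_nrm_le => [|x].
  by rewrite addr_ge0 ?mulr_ge0 ?nrm_ge0 ?exprn_ge0 ?nrm_ge0.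
set Q := bil_appr _ _ _.
have QE : Q k x = v y (frechet W y k (v y x)) by [].
(* First term: increment of [v] times increment of [W], hence quadratic. Second term: the
   first-order remainder of [W] between two bounded operators. *)
have -> : (v (y + k) - v y - (- Q) k) x =
   - (v (y + k) (dW (v y x)) - v y (dW (v y x)))
   - v y ((dW - frechet W y k) (v y x)).
  have -> : v y ((dW - frechet W y k) (v y x)) =
      v y (dW (v y x)) - v y (frechet W y k (v y x)).
    exact: (linearB (v y)).
  rewrite blinNE opprK blinDE QE (blinBE (v (y + k))) dv.
  set a := v (y + k) (dW _); set b := v y (dW _).
  by rewrite !opprB [RHS]addrC addrA subrK addrC.
rewrite (le_trans (nrmB _ _))// nrmN mulrDl lerD//.
  rewrite (le_trans (ndv _))//.
  have H : nrm (dW (v y x)) <= (c * nrm k) * (M * nrm x).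
    rewrite (le_trans (blin_nrm _ _))// ler_pM ?nrm_ge0//.
    by rewrite (le_trans (blin_nrm _ _))// ler_wpM2r ?nrm_ge0// vM.
  have P0 : 0 <= M * c * nrm k * M by rewrite !mulr_ge0 ?nrm_ge0.
  rewrite (le_trans (ler_wpM2l P0 H))//.
  by rewrite [leLHS](_ : _ = M * c * M * c * M * nrm k ^+ 2 * nrm x)//; ring.
rewrite (le_trans (blin_nrm _ _))// -!mulrA ler_pM ?nrm_ge0 ?vM//.
rewrite (le_trans (blin_nrm _ _))// mulrCA ler_wpM2l ?nrm_ge0//.
exact: le_trans (blin_nrm _ _) (ler_wpM2r (nrm_ge0 _) (vM _ Dy)).
Qed.

(** The derivative [- v W' v] is as regular as [v] and [W'] are, so each step gains one order for
    [v]. *)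
Lemma smooth_inverse m (W v : X -> blin X X) (D : set X) (M : R) : open D ->
  (forall y x, D y -> W y (v y x) = x) -> (forall y x, D y -> v y (W y x) = x) ->
  (forall y, D y -> nrm (v y) <= M) -> smooth m D W -> smooth m D v.
Proof.
move=> oD Wv vW vM; elim: m => // m IH sW.
apply: smooth_hasD => // [y Dy|].
  by apply: (hasD_inverse oD Dy Wv vW vM); case: sW => + _; exact.
have sv := IH (smooth_leS sW).
apply: smoothN => //.
apply: (smooth_bil oD (bil_appr_bbilin X (@bcomp_bbilin _ X X X)) sv).
apply: (smooth_bil oD (bil_appl_bbilin X (@bcomp_bbilin _ X X X)) _ sv).
by case: sW.
Qed.

End OperatorInverse.

(** * Regularity and derivatives of the local inverse *)

Section LocalInverse.
Context (R : realType) (X : completeNormedModType R[i]).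
Variables f h : X -> X.
Hypotheses (hf : normalized_holomorphic f) (hh : local_inverse f h).

(** Near 0, [f] expands distances by at least 1/2. Continuity of [h] at 0 brings its values into
    that region, and [f (h y) = y] makes it Lipschitz there; then [h' = f'(h)^-1] gives all further
    regularity. *)
Lemma inverse_germ : tangent_germ h.
Proof.
have [h0 ch _ fh] := hh.
have [r [K [r0 K0 rem]]] := normalized_remainder hf.
have [rf rf0 sf] := normalized_smooth hf 3.
have f1 := normalized_hasD0 hf.
have [df sA] := sf; have [dA _] := sA.
have [a a0 Ha] : exists2 a : R, 0 < a & forall x, nrm x < a ->
    nrm (frechet f x - blin_id X) <= 4^-1.
  have rf00 : [set x : X | nrm x < rf] 0 by rewrite /= nrm0.
  have q0 : 0 < 4^-1 :> R by rewrite invr_gt0.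
  have [a a0 Ha] := (continuous_nrmP _ _).1 (hasD_cont (diff_hasD (dA _ rf00))) _ q0.
  by exists a => // x xa; rewrite -(hasD_frechet f1) ltW// Ha// subr0.
(* [(8 * (K + 1))^-1] makes [K * nrm (x' - x) <= 1/4], and [a] costs another quarter through
   [f' - Id]; the remaining half is the constant 2 in [lower]. [r / 2] keeps [x' - x] of norm at
   most [r]. *)
pose rho := Num.min (Num.min a (r / 2)) (Num.min rf (8 * (K + 1))^-1).
have K1 : 0 < 8 * (K + 1) by rewrite mulr_gt0// ltr_wpDl.
have rho0 : 0 < rho by rewrite !lt_min a0 divr_gt0// rf0 invr_gt0.
have rhoP (x : X) : nrm x < rho ->
    [/\ nrm x < a, nrm x < r / 2, nrm x < rf & nrm x < (8 * (K + 1))^-1].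
  by rewrite !lt_min => /andP[/andP[-> ->] /andP[-> ->]].
have lower x x' : nrm x < rho -> nrm x' < rho ->
    nrm (x' - x) <= 2 * nrm (f x' - f x).
  move=> /rhoP[xa xr _ xK] /rhoP[_ x'r _ x'K].
  have nd : nrm (x' - x) <= nrm x' + nrm x := nrmB _ _.
  have dr : nrm (x' - x) <= r by lra.
  have xr' : nrm x <= r by lra.
  have := rem x (x' - x) xr' dr; rewrite addrCA subrr addr0 => H.
  have dK : K * nrm (x' - x) <= 4^-1.
    have : nrm (x' - x) <= 2 / (8 * (K + 1)) by lra.
    by rewrite ler_pdivlMr//; have := nrm_ge0 (x' - x); nra.
  have Hq : K * nrm (x' - x) ^+ 2 <= 4^-1 * nrm (x' - x).
    by rewrite expr2 mulrA ler_wpM2r ?nrm_ge0.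
  have HA := le_trans (blin_nrm _ (x' - x)) (ler_wpM2r (nrm_ge0 (x' - x)) (Ha _ xa)).
  have : nrm (x' - x) <= nrm (f x' - f x) +
      nrm (f x' - f x - frechet f x (x' - x)) +
      nrm ((frechet f x - blin_id X) (x' - x)).
    have {1}-> : x' - x = (f x' - f x) - (f x' - f x - frechet f x (x' - x))
        - (frechet f x - blin_id X) (x' - x).
      by rewrite blinBE 2!subKr.
    by rewrite (le_trans (nrmB _ _))// lerD2r (le_trans (nrmB _ _)).
  have := nrm_ge0 (x' - x); lra.
(* A pointwise choice, with value 0 outside the ball; its regularity along [h] comes later, from
   inverting [frechet f]. *)
have [V HV] : {V : X -> blin X X & forall x, nrm x < rho ->
    [/\ forall z, frechet f x (V x z) = z, forall z, V x (frechet f x z) = z &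
        nrm (V x) <= 2]}.
  apply: (@choice _ _ (fun x (V : blin X X) => nrm x < rho ->
    [/\ forall z, frechet f x (V z) = z,
     forall z, V (frechet f x z) = z & nrm V <= 2])) => x.
  have [/rhoP[xa _ _ _]|xr] := ltP (nrm x) rho; last by exists 0.
  by have [V HV] := neumann (Ha _ xa); exists V.
have [d d0 Hd] : exists2 d : R, 0 < d & forall y, nrm y < d ->
    nrm (h y) < rho /\ f (h y) = y.
  have /near0_nrmP[d d0 Hd] := fh.
  have [d' d'0 Hd'] := (continuous_nrmP _ _).1 ch _ rho0.
  exists (Num.min d d'); first by rewrite lt_min d0.
  move=> y; rewrite lt_min => /andP[/Hd fhy yd']; split => //.
  by have := Hd' y; rewrite h0 !subr0; exact.
pose D := [set y : X | nrm y < d].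
have oD : open D by exact: nrm_ball_open.
have D0 : D 0 by rewrite /D /= nrm0.
have hD y : D y -> hasD h y (V (h y)).
  move=> Dy; have [hy fhy] := Hd _ Dy; have [AV VA V2] := HV _ hy.
  (* The factor 2 bounds [V (h y)], and 4 is the square of the Lipschitz constant of [h]. *)
  have C0 : 0 <= 2 * (K * 4) by rewrite !mulr_ge0.
  pose t := Num.min (d - nrm y) (r / 2).
  have t0 : 0 < t by rewrite lt_min subr_gt0 Dy divr_gt0.
  apply/hasD_small; apply: (small_le t0 _ (small_sq X C0)) => k.
  rewrite lt_min => /andP[kd kr].
  have Dk : D (y + k) by rewrite /D /= (le_lt_trans (nrmD _ _))//; lra.
  have [hyk fhyk] := Hd _ Dk.
  have yk : y + k - y = k by rewrite addrC addKr.
  set l := h (y + k) - h y.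
  have lk : nrm l <= 2 * nrm k.
    by have := lower _ _ hy hyk; rewrite fhy fhyk yk.
  have := rem (h y) l; have [_ hyr _ _] := rhoP _ hy.
  have -> : h y + l = h (y + k) by rewrite [LHS]addrC subrK.
  rewrite fhy fhyk yk => H.
  have {}H : nrm (k - frechet f (h y) l) <= K * 4 * nrm k ^+ 2.
    apply: le_trans (H _ _) _; [lra|lra|].
    rewrite -mulrA ler_wpM2l//.
    have -> : 4 * nrm k ^+ 2 = (2 * nrm k) ^+ 2 by ring.
    by rewrite lerXn2r ?nnegrE ?mulr_ge0 ?nrm_ge0.
  have -> : l - V (h y) k = - V (h y) (k - frechet f (h y) l).
    by rewrite linearB /= VA opprB.
  rewrite nrmN (le_trans (blin_nrm _ _))// -mulrA.
  by rewrite ler_pM ?nrm_ge0.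
(* Bootstrap: if [h] has order [m], so does [f' o h], hence also its inverse [V o h = h']. *)
have sh m : smooth m [set x | nrm x < rf] (frechet f) -> smooth m.+1 D h.
  elim: m => [|m IH] sm; first by apply: (smooth_hasD oD hD).
  apply: (smooth_hasD oD hD).
  have hrf y : D y -> nrm (h y) < rf by move=> /Hd[/rhoP[]].
  apply: (@smooth_inverse _ _ _ (fun y => frechet f (h y)) _ _ 2 oD).
  - by move=> y x /Hd[/HV[]].
  - by move=> y x /Hd[/HV[]].
  - by move=> y /Hd[/HV[]].
  - apply: (smooth_comp (@nrm_ball_open R X rf) oD hrf sm).
    by apply: IH; exact: smooth_leS.
split => //; last by exists d => //; exact: sh.
rewrite (hasD_frechet (hD _ D0)) h0; apply: blin_ext => z.
have [AV _ _] : [/\ forall z, frechet f 0 (V 0 z) = z,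
    forall z, V 0 (frechet f 0 z) = z & nrm (V 0) <= 2] by apply: HV; rewrite nrm0.
by rewrite -{2}(AV z) (hasD_frechet f1).
Qed.

Lemma normalized_germ : tangent_germ f.
Proof.
split; [exact: normalized0|exact: hasD_frechet (normalized_hasD0 hf)|].
exact: normalized_smooth.
Qed.

Lemma inverse_derivatives e :
  (forall l k, D2at0 h l k = - D2at0 f l k) /\
  D3at0 h e e e = - D3at0 f e e e + 3 *: D2at0 f e (D2at0 f e e).
Proof.
have [_ _ _ fh] := hh.
have [_ c2 c3] := germ_comp normalized_germ inverse_germ.
(* The equation must be carried through each derivative on a neighborhood. With the identity on the
   left, the differentiability conditions concern only the identity and its derivatives. *)
have E0 : \forall x \near (0 : X), (fun x => x) x = (f \o h) x.
  by apply: filterS fh => x /= ->.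
have all0 (P : set X) : (forall x, P x) -> \forall x \near (0 : X), P x.
  by move=> H; exact: filterE.
have didS (x : X) : differentiable (fun x => x) x := hasD_diff (hasD_id x).
have id1 : frechet (fun x : X => x) = fun=> blin_id X.
  by apply/funext => x; exact: hasD_frechet (hasD_id x).
have E1 := eq_near0_frechet E0 (all0 _ didS).
have d1 (x : X) : differentiable (frechet (fun x : X => x)) x.
  by rewrite id1; exact: hasD_diff (hasD_cst _ x).
have E2 := eq_near0_frechet E1 (all0 _ d1).
have id2 : frechet (frechet (fun x : X => x)) = fun=> 0.
  by rewrite id1; apply/funext => x; exact: hasD_frechet (hasD_cst _ x).
have d2 (x : X) : differentiable (frechet (frechet (fun x : X => x))) x.
  by rewrite id2; exact: hasD_diff (hasD_cst _ x).
have E3 := eq_near0_frechet E2 (all0 _ d2).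
have D2E l k : D2at0 h l k = - D2at0 f l k.
  apply/eqP; rewrite -addr_eq0 addrC -c2.
  have -> : D2at0 (f \o h) = D2at0 (fun x => x) := esym (nbhs_singleton E2).
  by rewrite D2at0_id.
split => //; have := c3 e.
have -> : D3at0 (f \o h) = D3at0 (fun x => x) := esym (nbhs_singleton E3).
have L : D2at0 f e (- D2at0 f e e) = - D2at0 f e (D2at0 f e e) by exact: linearN.
rewrite D3at0_id !D2E (normalized_sym hf _ e) L.
set a := D3at0 f e e e; set b := D2at0 f e (D2at0 f e e).
have b3 : 3 *: b = b + 2 *: b.
  by rewrite -[X in X + _]scale1r -scalerDl; congr (_ *: _); ring.
rewrite scalerN -addrA -opprD -b3 => /esym/eqP; rewrite subr_eq0 => /eqP <-.
by rewrite addKr.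
Qed.

End LocalInverse.

(** * Root transforms *)

Section Vanish.
Context (R : realType).
Implicit Types Y Z W : normedModType R[i].

(** Big-O of [t^m] for real [t] tending to 0 from above; such [t] already determine Taylor
    coefficients. *)
Definition vanish Y (m : nat) (F : R -> Y) := exists C d : R,
  [/\ 0 <= C, 0 < d & forall t, 0 < t -> t < d -> nrm (F t) <= C * t ^+ m].

Lemma vanishD Y m (F G : R -> Y) :
  vanish m F -> vanish m G -> vanish m (fun t => F t + G t).
Proof.
move=> [C [d [C0 d0 H]]] [C' [d' [C'0 d'0 H']]].
exists (C + C'), (Num.min d d'); split; [exact: addr_ge0|by rewrite lt_min d0|].
move=> t t0; rewrite lt_min => /andP[td td'].
by rewrite (le_trans (nrmD _ _))// mulrDl lerD ?H ?H'.
Qed.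

Lemma vanish_bil Y Z W (B : Y -> Z -> W) m k (F : R -> Y) (G : R -> Z) :
  bbilin B -> vanish m F -> vanish k G -> vanish (m + k) (fun t => B (F t) (G t)).
Proof.
move=> [_ _ [M M0 HM]] [C [d [C0 d0 H]]] [C' [d' [C'0 d'0 H']]].
exists (M * C * C'), (Num.min d d'); split; [by rewrite !mulr_ge0|by rewrite lt_min d0|].
move=> t t0; rewrite lt_min => /andP[td td'].
rewrite (le_trans (HM _ _))// exprD.
have -> : M * C * C' * (t ^+ m * t ^+ k) = M * (C * t ^+ m) * (C' * t ^+ k) by ring.
by rewrite ler_pM ?nrm_ge0 ?mulr_ge0 ?nrm_ge0 ?H'// ler_wpM2l ?H.
Qed.

Lemma vanish_le Y m k (F : R -> Y) : (k <= m)%N -> vanish m F -> vanish k F.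
Proof.
move=> km [C [d [C0 d0 H]]]; exists C, (Num.min d 1); split => //.
  by rewrite lt_min d0 ltr01.
move=> t t0; rewrite lt_min => /andP[td t1]; rewrite (le_trans (H _ t0 td))//.
by rewrite ler_wpM2l// ler_wiXn2l// ltW.
Qed.

Lemma vanish_ext Y m (F G : R -> Y) (d : R) : 0 < d ->
  (forall t, 0 < t -> t < d -> F t = G t) -> vanish m F -> vanish m G.
Proof.
move=> d0 FG [C [d' [C0 d'0 H]]]; exists C, (Num.min d d'); split => //.
  by rewrite lt_min d0.
by move=> t t0; rewrite lt_min => /andP[td td']; rewrite -FG// H.
Qed.

Lemma vanish_cst Y (v : Y) : vanish 0 (fun=> v).
Proof.
exists (nrm v), 1; split => //; first exact: nrm_ge0.
by move=> t _ _; rewrite expr0 mulr1.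
Qed.

Lemma scale_bbilin Y : bbilin (fun (a : R[i]^o) (y : Y) => a *: y).
Proof.
split=> [y a b c|a b x y|]; first by rewrite scalerDl scalerA.
  by rewrite scalerDr !scalerA mulrC.
by exists 1 => // a y; rewrite mul1r nrmZ.
Qed.

Lemma vanish_exp n : vanish n (fun t : R => t%:C ^+ n : R[i]^o).
Proof.
exists 1, 1; split => // t t0 _.
by rewrite mul1r nrmCX nrmC_real ger0_norm// ltW.
Qed.

Lemma vanishX Y n m (F : R -> Y) : vanish m F -> vanish (n + m) (fun t => t%:C ^+ n *: F t).
Proof. exact: (vanish_bil (scale_bbilin Y) (vanish_exp n)). Qed.

Lemma vanishZ Y m (a : R[i]) (F : R -> Y) : vanish m F -> vanish m (fun t => a *: F t).
Proof. exact: (vanish_bil (scale_bbilin Y) (vanish_cst (a : R[i]^o))). Qed.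

Lemma vanishN Y m (F : R -> Y) : vanish m F -> vanish m (fun t => - F t).
Proof.
move=> H; apply: vanish_ext ltr01 _ (vanishZ (-1) H) => t _ _.
by rewrite scaleN1r.
Qed.

(** The constant coefficient is O(t), hence 0; dividing by [t] shifts the coefficients and lowers
    the order. *)
Lemma vanish_coef0 Y (c : nat -> Y) m :
  vanish m (fun t => \sum_(k < m) t%:C ^+ k *: c k) -> forall k, (k < m)%N -> c k = 0.
Proof.
elim: m c => // m IH c H.
have SE t : \sum_(k < m.+1) t%:C ^+ k *: c k =
    c 0%N + t%:C *: \sum_(k < m) t%:C ^+ k *: c k.+1.
  rewrite big_ord_recl expr0 scale1r scaler_sumr; congr (_ + _).
  by apply: eq_bigr => k _; rewrite lift0 scalerA -exprS.
have c0 : c 0%N = 0.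
  have [C [d [C0 d0 Hd]]] : vanish 1 (fun=> c 0%N).
    have H2 : vanish 1 (fun t => t%:C *: \sum_(k < m) t%:C ^+ k *: c k.+1).
      apply: (@vanishX _ 1 0); exists (\sum_(k < m) nrm (c k.+1)), 1; split => //.
        by rewrite sumr_ge0// => k _; exact: nrm_ge0.
      move=> t t0 t1; rewrite expr0 mulr1 (le_trans (nrm_sum _ _ _))//.
      apply: ler_sum => k _; rewrite nrmZ nrmCX nrmC_real ger0_norm ?(ltW t0)//.
      by rewrite ler_piMl ?nrm_ge0// exprn_ile1// ltW.
    apply: (vanish_ext ltr01 _ (vanishD (vanish_le _ H) (vanishN H2))) => // t _ _.
    by rewrite SE addrK.
  apply: nrm0P; apply/ler_addgt0Pr => /= eps eps0; rewrite add0r.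
  have C1 : 0 < C + 1 by rewrite ltr_wpDl.
  pose t := Num.min (d / 2) (eps / (C + 1)).
  have t0 : 0 < t by rewrite lt_min !divr_gt0.
  have td : t < d.
    have : t <= d / 2 by rewrite /t ge_min lexx.
    lra.
  have te : t <= eps / (C + 1) by rewrite /t ge_min lexx orbT.
  rewrite (le_trans (Hd _ t0 td))// expr1.
  by move: te; rewrite ler_pdivlMr//; lra.
case=> [//|k]; rewrite ltnS; apply: (IH (fun k => c k.+1)).
have [C [d [C0 d0 Hd]]] := H; exists C, d; split => // t t0 td.
have := Hd t t0 td; rewrite SE c0 add0r nrmZr ?(ltW t0)// exprS.
by rewrite mulrCA ler_pM2l.
Qed.

End Vanish.

Section TaylorLine.
Context (R : realType) (X : completeNormedModType R[i]).

Lemma normalized_vanish (f : X -> X) (e : X) m : normalized_holomorphic f -> nrm e = 1 ->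
  vanish m (fun t => f (t%:C *: e) - \sum_(k < m) t%:C ^+ k *: taylor_term f k e).
Proof.
move=> hf e1; have [r [M [r0 M0 H]]] := normalized_taylor hf.
exists (M / r ^+ m), r; split => // [|t t0 tr].
  by rewrite divr_ge0// exprn_ge0// ltW.
(* The Taylor bound holds on the ball of radius [r], so [t e] is written as [(t / r) (r e)]. *)
have := H (r%:C *: e) (t / r)%:C m; rewrite nrmZr ?(ltW r0)// e1 mulr1.
rewrite nrmC_real ger0_norm ?divr_ge0 ?(ltW t0) ?(ltW r0)//.
rewrite ler_pdivrMr// mul1r => /(_ (lexx _) (ltW tr)).
have -> : (t / r)%:C *: (r%:C *: e) = t%:C *: e.
  by rewrite scalerA -rmorphM /= divfK// gt_eqF.
rewrite expr_div_n mulrA mulrAC.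
under eq_bigr => k _.
  rewrite (form_scale _ _ (taylor_term_form f k)) scalerA -exprMn -rmorphM /=.
  rewrite divfK ?gt_eqF//; over.
by [].
Qed.

End TaylorLine.

(** * The binomial series of an operator *)

Section BinomialPower.
Context (R : realType) (X : completeNormedModType R[i]).

(** Each factor satisfies [|1/n - i| <= i + 1], so the product is at most [k!]. *)
Lemma gbinom_le1 n k : (0 < n)%N -> nrm (gbinom (n%:R^-1 : R[i]) k : R[i]^o) <= 1.
Proof.
move=> n0; rewrite /gbinom nrmCM nrmCV nrmC_nat ler_pdivrMr ?ltr0n ?fact_gt0// mul1r.
elim: k => [|k IH]; first by rewrite big_ord0 nrmC1.
rewrite big_ord_recr /= nrmCM factS natrM mulrC ler_pM ?nrm_ge0//.
rewrite (le_trans (nrmB _ _))// nrmC_nat nrmCV nrmC_nat -(natr1 k) addrC lerD2l.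
by rewrite invf_le1 ?ltr0n// ler1n.
Qed.

Lemma series3 (Y : normedModType R[i]) (w : nat -> Y) :
  series w 3%N = w 0%N + w 1%N + w 2%N.
Proof. by rewrite /series /= !big_nat_recr//= big_geq// add0r. Qed.

(** Second order suffices for root transforms: there [K - Id] is O(t^n) and [v = t e], so the cubic
    error is O(t^(3n+1)), beyond the coefficient of index [2n+1]. *)
Lemma blin_pow_expansion (K : blin X X) n v : (0 < n)%N -> nrm (K - blin_id X) <= 2^-1 ->
  nrm (blin_pow K n%:R^-1 v - (v + n%:R^-1 *: (K - blin_id X) v +
    gbinom n%:R^-1 2 *: (K - blin_id X) ((K - blin_id X) v))) <=
  16 * nrm (K - blin_id X) ^+ 3 * nrm v.
Proof.
move=> n0 K2; set T := K - blin_id X.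
pose a := n%:R^-1 : R[i].
have TX k : nrm (blin_exp T k) <= nrm T ^+ k.
  elim: k => [|k IH].
    by apply: blin_nrm_le => // x; rewrite expr0 mul1r.
  rewrite exprS; apply: blin_nrm_le => [|x]; first by rewrite mulr_ge0 ?exprn_ge0 ?nrm_ge0.
  have -> : blin_exp T k.+1 x = T (blin_exp T k x) by [].
  rewrite (le_trans (blin_nrm _ _))// -mulrA ler_wpM2l ?nrm_ge0//.
  by rewrite (le_trans (blin_nrm _ _))// ler_wpM2r ?nrm_ge0.
pose u k : blin X X := gbinom a k *: blin_exp T k.
have uT k : nrm (u k) <= nrm T ^+ k.
  rewrite nrmZ (le_trans _ (TX k))// ler_piMl ?nrm_ge0//.
  exact: gbinom_le1.
have uM k : nrm (u k) <= 1 * 2^-1 ^+ k.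
  by rewrite mul1r (le_trans (uT k))// lerXn2r ?nnegrE ?nrm_ge0 ?invr_ge0.
have [S HS] := blin_geometric (@complete_geometric _ X) uM.
have -> : blin_pow K a = S by exact: (cvg_lim (@norm_hausdorff _ _) HS).
have Sv := series_app (x := v) HS.
have u3 : series (fun k => u k v) 3%N = v + a *: T v + gbinom a 2 *: T (T v).
  rewrite series3.
  have -> : u 0%N v = v.
    by rewrite blinZE /gbinom big_ord0 divr1 scale1r.
  have -> : u 1%N v = a *: T v.
    by rewrite blinZE /gbinom big_ord1 subr0 divr1.
  by [].
rewrite -u3; pose w k := if (k < 3)%N then 0 else u k v.
(* The tail starts at index 3, and [8 = 2^3] re-bases the geometric decay at index 0. *)
have wM k : nrm (w k) <= (8 * nrm T ^+ 3 * nrm v) * 2^-1 ^+ k.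
  rewrite /w; case: ltnP => [_|k3].
    by rewrite nrm0 !mulr_ge0 ?exprn_ge0 ?nrm_ge0 ?invr_ge0.
  rewrite (le_trans (blin_nrm _ _))// mulrAC ler_wpM2r ?nrm_ge0//.
  rewrite (le_trans (uT k))// -(subnKC k3) !exprD.
  have -> : 8 * nrm T ^+ 3 * (2^-1 ^+ 3 * 2^-1 ^+ (k - 3)) =
     nrm T ^+ 3 * 2^-1 ^+ (k - 3) by field.
  by rewrite ler_wpM2l ?exprn_ge0 ?nrm_ge0// lerXn2r ?nnegrE ?nrm_ge0 ?invr_ge0.
have -> : 16 * nrm T ^+ 3 * nrm v = 2 * (8 * nrm T ^+ 3 * nrm v) by ring.
apply: series_lim_bound wM _.
have : (fun n => series (fun k => u k v) n - series (fun k => u k v) 3%N) @ \oo -->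
       S v - series (fun k => u k v) 3%N.
  by apply: cvgB => //; exact: cvg_cst.
apply: cvg_trans; apply: near_eq_cvg; exists 3%N => // m /= m3.
rewrite /series /= !(big_cat_nat (leq0n 3) m3)/=.
rewrite [X in X - _]addrC addrK [X in _ = X + _]big_nat [X in _ = X + _]big1 => [|k /andP[_ k3]].
  by rewrite add0r; apply: eq_big_nat => k /andP[k3 _]; rewrite /w ltnNge k3.
by rewrite /w k3.
Qed.

End BinomialPower.

Section Approximation.
Context (R : realType).
Implicit Types Y Z W : normedModType R[i].

Definition approx Y m (F G : R -> Y) := vanish m (fun t => F t - G t).

Lemma approx_refl Y m (F : R -> Y) : approx m F F.
Proof.
by exists 0, 1; split => // t _ _; rewrite subrr nrm0 mul0r.
Qed.

Lemma approx_trans Y m (F G H : R -> Y) :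
  approx m F G -> approx m G H -> approx m F H.
Proof.
move=> FG GH; apply: vanish_ext ltr01 _ (vanishD FG GH) => t _ _.
by rewrite addrA subrK.
Qed.

Lemma approx_sym Y m (F G : R -> Y) : approx m F G -> approx m G F.
Proof. by move=> FG; apply: vanish_ext ltr01 _ (vanishN FG) => t _ _; rewrite opprB. Qed.

Lemma approxD Y m (F G F' G' : R -> Y) : approx m F F' -> approx m G G' ->
  approx m (fun t => F t + G t) (fun t => F' t + G' t).
Proof.
by move=> FG GH; apply: vanish_ext ltr01 _ (vanishD FG GH) => t _ _; rewrite opprD addrACA.
Qed.

Lemma approxZ Y m (a : R[i]) (F G : R -> Y) : approx m F G ->
  approx m (fun t => a *: F t) (fun t => a *: G t).
Proof. by move=> FG; apply: vanish_ext ltr01 _ (vanishZ a FG) => t _ _; rewrite scalerBr. Qed.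

Lemma approxX Y m n (F G : R -> Y) : approx m F G ->
  approx (n + m) (fun t => t%:C ^+ n *: F t) (fun t => t%:C ^+ n *: G t).
Proof. by move=> FG; apply: vanish_ext ltr01 _ (vanishX n FG) => t _ _; rewrite scalerBr. Qed.

Lemma approx_app Y Z m n (T : R -> blin Y Z) (F G : R -> Y) :
  vanish n T -> approx m F G ->
  approx (n + m) (fun t => T t (F t)) (fun t => T t (G t)).
Proof.
move=> TO FG; apply: vanish_ext ltr01 _ (vanish_bil (@bapp_bbilin _ Y Z) TO FG) => t _ _.
exact: linearB.
Qed.

Lemma approx_le Y m k (F G : R -> Y) : (k <= m)%N -> approx m F G -> approx k F G.
Proof. by move=> km; exact: vanish_le. Qed.

Lemma approx_eq Y m (F G : R -> Y) (d : R) : 0 < d ->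
  (forall t, 0 < t -> t < d -> F t = G t) -> approx m F G.
Proof.
move=> d0 FG; apply: (vanish_ext d0 _ (approx_refl m F)) => t t0 td.
by rewrite -FG// subrr.
Qed.

Lemma approxDr Y m (F G : R -> Y) : vanish m G -> approx m (fun t => F t + G t) F.
Proof.
move=> GO; apply: (vanish_ext ltr01 _ GO) => t _ _.
by rewrite addrC addrA [- _ + _]addrC subrr add0r.
Qed.

Lemma approx_coef Y m (c c' : nat -> Y) :
  approx m (fun t => \sum_(k < m) t%:C ^+ k *: c k)
           (fun t => \sum_(k < m) t%:C ^+ k *: c' k) ->
  forall k, (k < m)%N -> c k = c' k.
Proof.
move=> H k km; apply/eqP; rewrite -subr_eq0; apply/eqP.
apply: (@vanish_coef0 _ _ (fun k => c k - c' k) m _ _ km).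
apply: (vanish_ext ltr01 _ H) => t _ _; rewrite -sumrB; apply: eq_bigr => j _.
by rewrite scalerBr.
Qed.

Lemma sum_single Y m (t : R[i]) j (v : Y) : (j < m)%N ->
  \sum_(k < m) t ^+ k *: (if k == j :> nat then v else 0) = t ^+ j *: v.
Proof.
move=> jm; rewrite (bigD1 (Ordinal jm)) //= eqxx big1 ?addr0// => k kj.
by rewrite ifN ?scaler0//; move: kj; rewrite -val_eqE.
Qed.

End Approximation.

(** * The coefficient of the root transform *)

Section RootTransform.
Context (R : realType) (X : completeNormedModType R[i]).
Variables (e : X) (es : dual X) (f g : X -> X) (n : nat) (nu : R[i]).
Hypotheses (e1 : nrm e = 1) (es1 : es e = 1) (n0 : (0 < n)%N).
Hypotheses (hf : normalized_holomorphic f) (hg : normalized_holomorphic g).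
Hypothesis P2nu : homog f 2 e = nu *: e.
Hypothesis hroot : root_transform n e es f g.

Lemma near0_line (P : set X) k : (0 < k)%N -> (\forall x \near (0 : X), P x) ->
  exists2 d : R, 0 < d & forall t : R, 0 < t -> t < d -> P (t%:C ^+ k *: e).
Proof.
move=> k0 /near0_nrmP[d d0 dP]; exists (Num.min d 1); first by rewrite lt_min d0 ltr01.
move=> t t0; rewrite lt_min => /andP[td t1]; apply: dP.
rewrite nrmZ nrmCX nrmC_real ger0_norm ?(ltW t0)// e1 mulr1.
by rewrite (le_lt_trans _ td)// ler_iXnr ?(ltW t0) ?(ltW t1).
Qed.

(* Of [kappa] only the first-order behaviour at 0 enters: [T = kappa z - Id] is
   O(z), and [T z = f z - z] gives [T e] and [T (T e)] up to the needed order
   because [P_2 e] is a multiple of [e]. *)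
Lemma root_transform_coef : homog g (2 * n + 1) e =
  n%:R^-1 *: homog f 3 e + (gbinom n%:R^-1 2 * nu ^+ 2) *: e.
Proof.
have [kappa [hk k1 fk gk]] := hroot.
set a := n%:R^-1; set b := gbinom a 2; set P3 := homog f 3 e.
have [T TK] : exists T : R -> blin X X,
  forall t, kappa (t%:C ^+ n *: e) - blin_id X = T t by eexists.
have TE t v : T t v = kappa (t%:C ^+ n *: e) v - v by rewrite -TK.
have TO : vanish n T.
  have [d d0 Hd] := hasD_lipschitz (diff_hasD (nbhs_singleton hk)).
  set c := nrm _ + 1 in Hd; have c0 : 0 <= c by rewrite addr_ge0 ?nrm_ge0.
  exists c, (Num.min d 1); split => //; first by rewrite lt_min d0 ltr01.
  move=> t t0; rewrite lt_min => /andP[td t1].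
  have nt : nrm (t%:C ^+ n *: e) = t ^+ n.
    by rewrite nrmZ nrmCX nrmC_real ger0_norm ?(ltW t0)// e1 mulr1.
  have := Hd (t%:C ^+ n *: e); rewrite nt add0r k1 TK; apply.
  by rewrite (le_lt_trans _ td)// ler_iXnr ?(ltW t0) ?(ltW t1).
have Te : approx (3 * n) (fun t => T t e)
    (fun t => t%:C ^+ n *: (nu *: e) + t%:C ^+ (n + n) *: P3).
  (* At [z = t^n e] the expansion of [f z - z = T z] has error [t^(4n)]; dividing by [t^n] leaves
     [t^(3n)] for [T e]. *)
  have [C [d [C0 d0 Hd]]] := normalized_vanish 4 hf e1.
  have [d' d'0 Hd'] := near0_line n0 fk.
  exists C, (Num.min (Num.min d 1) d'); split => //.
    by rewrite !lt_min d0 ltr01.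
  move=> t t0; rewrite !lt_min => /andP[/andP[td t1] td'].
  have s0 : 0 < t ^+ n by rewrite exprn_gt0.
  have sd : t ^+ n < d by rewrite (le_lt_trans _ td)// ler_iXnr ?(ltW t0) ?(ltW t1).
  have sE : (t ^+ n)%:C = t%:C ^+ n by rewrite rmorphXn.
  have := Hd _ s0 sd; rewrite sE (Hd' t t0 td').
  rewrite 4!big_ord_recr big_ord0 /= add0r {1 2}/taylor_term /= !taylor_term_ge2//.
  rewrite scaler0 add0r P2nu expr1.
  have -> : kappa (t%:C ^+ n *: e) (t%:C ^+ n *: e) -
     (t%:C ^+ n *: e + (t%:C ^+ n) ^+ 2 *: (nu *: e) + (t%:C ^+ n) ^+ 3 *: homog f 3 e) =
     (t ^+ n)%:C *: (T t e - (t%:C ^+ n *: (nu *: e) + t%:C ^+ (n + n) *: P3)).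
    rewrite sE scalerBr scalerDr.
    have -> : t%:C ^+ n *: T t e = T t (t%:C ^+ n *: e).
      by apply/esym; exact: linearZ.
    rewrite TE exprD !scalerA -[X in _ - X]addrA opprD addrA.
    by congr (_ - (_ *: _ + _ *: _)); ring.
  rewrite nrmZr ?(ltW s0)// exprS mulrCA ler_pM2l// => H.
  by rewrite mulnC exprM.
(* The leading part of [T e] is a multiple of [e], so the expansion of [T e] can be used a second
   time; [T P3] only contributes at order [t^(3n)]. *)
have TTe : approx (3 * n) (fun t => T t (T t e))
    (fun t => t%:C ^+ (n + n) *: (nu ^+ 2 *: e)).
  apply: (approx_trans (approx_le _ (approx_app TO Te))); first by rewrite leq_addl.
  apply: (@approx_trans _ _ _ _ (fun t => t%:C ^+ n *: (nu *: T t e))).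
    have OP3 : vanish (3 * n) (fun t => t%:C ^+ (n + n) *: T t P3).
      have -> : (3 * n = (n + n) + (n + 0))%N by lia.
      exact: vanishX (vanish_bil (@bapp_bbilin _ X X) TO (vanish_cst P3)).
    apply: approx_trans (approxDr _ OP3); apply: (approx_eq _ ltr01) => t _ _.
    have TZ (z : R[i]) v : T t (z *: v) = z *: T t v by exact: linearZ.
    by rewrite linearD /= (TZ (t%:C ^+ n)) (TZ nu) (TZ (t%:C ^+ (n + n)%N)).
  have H := approxX n (approxZ nu Te).
  apply: (approx_trans (approx_le _ H)); first by rewrite leq_addl.
  have OP3 : vanish (3 * n) (fun t => t%:C ^+ n *: (t%:C ^+ (n + n) *: (nu *: P3))).
    have -> : (3 * n = n + ((n + n) + 0))%N by lia.
    do 2 apply: vanishX; exact: vanish_cst.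
  apply: approx_trans (approxDr _ OP3); apply: (approx_eq _ ltr01) => t _ _.
  by rewrite scalerDr scalerDr exprD; congr (_ + _); rewrite !scalerA; congr (_ *: _); ring.
have gO : approx (3 * n + 1) (fun t => g (t%:C *: e))
   (fun t => t%:C ^+ 1 *: (e + a *: T t e + b *: T t (T t e))).
  have [C [d [C0 d0 Hd]]] := TO.
  have [d' d'0 Hd'] := near0_line (isT : 0 < 1)%N gk.
  (* The last cap gives [nrm (T t) <= C * t^n <= 1/2], as the binomial expansion requires. *)
  pose r := Num.min (Num.min d d') (Num.min 1 (2^-1 / (C + 1))).
  have C1 : 0 < C + 1 by rewrite ltr_wpDl.
  have r0 : 0 < r by rewrite !lt_min d0 d'0 ltr01 divr_gt0.
  exists (16 * C ^+ 3), r; split => //; first by rewrite mulr_ge0 ?exprn_ge0.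
  move=> t t0; rewrite !lt_min => /andP[/andP[td td'] /andP[t1 tC]].
  have HT := Hd t t0 td.
  have T2 : nrm (T t) <= 2^-1.
    have ttn : t ^+ n <= t by rewrite ler_iXnr ?(ltW t0) ?(ltW t1).
    rewrite (le_trans HT)//; move: tC; rewrite ltr_pdivlMr// => tC.
    have := ler_wpM2l C0 ttn; lra.
  have := Hd' t t0 td'; rewrite expr1.
  have -> : es (t%:C *: e) = t%:C.
    by rewrite linearZ /= es1; exact: mulr1.
  move=> ->.
  have := @blin_pow_expansion _ _ (kappa (t%:C ^+ n *: e)) n (t%:C *: e) n0.
  rewrite TK -/a -/b => /(_ T2).
  have TZ v : T t (t%:C *: v) = t%:C *: T t v by exact: linearZ.
  rewrite !TZ !scalerDr !(scalerA t%:C) !(mulrC t%:C) -!scalerA.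
  move=> H; apply: (le_trans H).
  have H3 : nrm (T t) ^+ 3 <= C ^+ 3 * t ^+ (3 * n).
    rewrite mulnC exprM -exprMn.
    by rewrite lerXn2r ?nnegrE ?nrm_ge0 ?mulr_ge0 ?exprn_ge0 ?(ltW t0).
  rewrite nrmZr ?(ltW t0)// e1 mulr1 exprD expr1.
  have := ler_wpM2r (ltW t0) H3.
  by move: (nrm _ ^+ 3) (C ^+ 3) (t ^+ _) => p q s; lra.
pose c (k : nat) : X := (if k == 1%N then e else 0) + (if k == n.+1 then a *: (nu *: e) else 0)
  + (if k == (2 * n + 1)%N then a *: P3 + (b * nu ^+ 2) *: e else 0).
have key : approx (2 * n + 2)
    (fun t => \sum_(k < 2 * n + 2) t%:C ^+ k *: taylor_term g k e)
    (fun t => \sum_(k < 2 * n + 2) t%:C ^+ k *: c k).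
  apply: (approx_trans (approx_sym (normalized_vanish (2 * n + 2) hg e1))).
  (* The available error is just enough: for [n = 1] both orders equal 4. *)
  have le3 : (2 * n + 2 <= 3 * n + 1)%N by lia.
  apply: (approx_trans (approx_le le3 gO)).
  have H := approxX 1 (approxD (approxD (approx_refl (3 * n) (fun=> e)) (approxZ a Te))
     (approxZ b TTe)).
  apply: (approx_trans (approx_le _ H)); first by lia.
  apply: (approx_eq _ ltr01) => t _ _.
  rewrite /c; under [RHS]eq_bigr do rewrite !scalerDr.
  rewrite !big_split /= !sum_single; try lia.
  have alg (V : lmodType R[i]) (u v : V) (z s x y w : R[i]) :
    z *: (u + x *: (s *: (w *: u) + (s * s) *: v) + y *: ((s * s) *: (w ^+ 2 *: u))) =
    z *: u + (z * s) *: (x *: (w *: u)) + (z * (s * s)) *: (x *: v + (y * w ^+ 2) *: u).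
    rewrite !scalerDr !scalerA !addrA.
    by congr (_ + _ *: _ + _ *: _ + _ *: _); ring.
  have -> : (2 * n + 1 = (n + n).+1)%N by lia.
  by rewrite expr1 (exprS _ n) (exprS _ (n + n)) exprD alg.
have k2n : (2 * n + 1 < 2 * n + 2)%N by rewrite addn2 addn1.
have := @approx_coef _ _ _ (fun k => taylor_term g k e) c key _ k2n.
rewrite /= taylor_term_ge2; last by lia.
move=> ->; rewrite /c eqxx.
have -> : (2 * n + 1 == 1)%N = false by apply/eqP; lia.
have -> : (2 * n + 1 == n.+1)%N = false by apply/eqP; lia.
by rewrite !add0r.
Qed.

End RootTransform.

(** * One-dimensional type and unitary invariance *)

Section OneDimensional.
Context (R : realType) (X : normedModType R[i]).
Variables (e : X) (es : dual X) (f : X -> X) (n : nat) (s r : X -> R[i]^o).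
Hypotheses (e1 : nrm e = 1) (nes : nrm es = 1) (n0 : (0 < n)%N).
Hypotheses (fs : forall x, unit_ball X x -> f x = s x *: x) (uf : univalent f).
Hypothesis hr : root_branch n s r.

Lemma unit_ballE (x : X) : unit_ball X x <-> nrm x < 1.
Proof. by rewrite /unit_ball /= nrmE -[1](rmorph1 (real_complex R)) ltcR. Qed.

Lemma dual_pow_ball x : unit_ball X x -> unit_ball X ((es x : R[i]) ^+ n *: e).
Proof.
move=> /unit_ballE x1; apply/unit_ballE; rewrite nrmZ nrmCX e1 mulr1.
have H : nrm (es x) <= nrm x by rewrite (le_trans (blin_nrm _ _))// nes mul1r.
by rewrite exprn_ilt1 ?nrm_ge0 ?gtn_eqF// (le_lt_trans H).
Qed.

Lemma dual_pow_hasD x k (v : X) : exists L, hasD (fun y => (es y : R[i]) ^+ k *: v) x L.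
Proof.
elim: k => [|k [L HL]].
  by exists 0; under eq_fun do rewrite expr0 scale1r; exact: hasD_cst.
eexists; under eq_fun do rewrite exprS -scalerA.
exact: (hasD_bil (scale_bbilin X) (hasD_blin es x) HL).
Qed.

(** Applying [es] gives [f (es(x)^n e) = es(g x)^n e]. So [g x = g y] and injectivity of [f] yield
    equal arguments of [r], whose common nonzero value cancels. *)
Lemma root_transform_one_dim :
  let g := fun x : X => r ((es x : R[i]) ^+ n *: e) *: x in
  one_dim_type g /\ univalent g.
Proof.
move=> g; have [hol r0 rn] := hr; have [_ injf] := uf.
pose q (x : X) : R[i]^o := r ((es x : R[i]) ^+ n *: e).
have Dq x : unit_ball X x -> exists L, hasD q x L.
  move=> /dual_pow_ball/hol/diff_hasD Dr; have [L HL] := dual_pow_hasD x n e.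
  by exists (bcomp (frechet r ((es x : R[i]) ^+ n *: e)) L); exact: hasD_comp.
split.
  by exists q => // x /Dq[L /hasD_diff].
split=> [x /Dq[L HL]|x y].
  apply: hasD_diff; exact: (hasD_bil (scale_bbilin X) HL (hasD_id x)).
rewrite !inE => xb yb gxy.
have bx := dual_pow_ball xb; have by_ := dual_pow_ball yb.
have b0 : unit_ball X 0 by apply/unit_ballE; rewrite nrm0.
(* A zero [z] of [s] has [f z = 0 = f 0], which forces [z = 0]; but [s 0 = (r 0)^n = 1], so [s] has
   no zeros. *)
have fz z : unit_ball X z -> s z = 0 -> z = 0.
  move=> zb sz; apply: injf; rewrite ?inE//.
  by rewrite !fs// sz scale0r scaler0.
have sn0 z : unit_ball X z -> s z != 0.
  move=> zb; apply/eqP => sz.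
  have := rn _ b0; rewrite r0 expr1n => /esym s0.
  by move: (s0); rewrite -(fz z zb sz) sz => /esym/eqP; rewrite oner_eq0.
have qE z : es (g z) = (q z : R[i]) * (es z : R[i]).
  have -> : g z = (q z : R[i]) *: z by [].
  exact: linearZ.
have fE z : unit_ball X z ->
    f ((es z : R[i]) ^+ n *: e) = (es (g z) : R[i]) ^+ n *: e.
  move=> zb; rewrite fs; last exact: dual_pow_ball.
  by rewrite scalerA qE exprMn (rn _ (dual_pow_ball zb)).
have E : (es x : R[i]) ^+ n *: e = (es y : R[i]) ^+ n *: e.
  by apply: injf; rewrite ?inE// !fE// gxy.
have qn0 : (q x : R[i]) != 0.
  by apply/eqP => q0; have := sn0 _ bx; rewrite -rn// -/(q x) q0 expr0n gtn_eqF// eqxx.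
apply: (scalerI qn0).
by have : g x = g y := gxy; rewrite /g -E.
Qed.

End OneDimensional.

(** * Duality in Hilbert space and conjugation by operators *)

Section UnitaryInvariance.
Context (R : realType) (X : normedModType R[i]).

Lemma dualityP (e : X) (es : dual X) : `|e| = 1 -> duality_map e es ->
  [/\ nrm e = 1, es e = 1 & nrm es = 1].
Proof.
move=> e1 [nes ->]; rewrite e1 expr1n; split => //.
  by rewrite /nrm e1.
by rewrite /nrm nes e1.
Qed.

(* [w = e - t z] is chosen orthogonal to [z = x - es x e], in the kernel of [es];
   then [1 = es w <= |w|] leaves no room for a component of [e] along [z]. *)
Lemma duality_dot (dot : {dot X for Num.conj}) (e : X) (es : dual X) x :
  hilbert_dot dot -> `|e| = 1 -> duality_map e es -> es x = dot x e.
Proof.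
move=> hd e1 de; have [ne es1 nes] := dualityP e1 de.
have ee : dot e e = 1 by rewrite -hd e1 expr1n.
pose z := x - (es x : R[i]) *: e.
have esz : es z = 0.
  rewrite linearB /=.
  have -> : es ((es x : R[i]) *: e) = (es x : R[i]) * es e by exact: linearZ.
  by rewrite es1 mulr1 subrr.
suff ez : dot e z = 0.
  have : dot z e = 0 by apply/eqP; rewrite herm_eq0C; apply/eqP; exact: ez.
  by rewrite linearBl linearZl_LR /= ee mulr1 => /eqP; rewrite subr_eq0 => /eqP ->.
have [->|zn0] := eqVneq z 0; first by rewrite linear0r.
have zz : 0 < dot z z by rewrite dnorm_gt0.
pose t := dot e z / dot z z; pose q := `|dot e z| ^+ 2 / dot z z.
have dq : dot e (t *: z) = q.
  rewrite linearZr_LR /= /t /q rmorphM fmorphV /= normCK.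
  by rewrite (geC0_conj (ltW zz)) mulrAC (mulrC (dot e z)).
have tz : dot (t *: z) (t *: z) = q.
  rewrite dnormZ /t normrM normfV (gtr0_norm zz) expr_div_n /q.
  by rewrite expr2 [dot z z ^+ 2]expr2 invfM mulrA divfK// gt_eqF.
have q0 : 0 <= q by rewrite divr_ge0 ?exprn_ge0// ltW.
have w1 : 1 <= `|e - t *: z|.
  rewrite nrmE -[1](rmorph1 (real_complex R)) lecR.
  have := blin_nrm es (e - t *: z); rewrite nes mul1r linearB /=.
  have -> : es (t *: z) = t * es z by exact: linearZ.
  by rewrite esz mulr0 subr0 es1 nrmC1.
have : 1 <= `|e - t *: z| ^+ 2 by rewrite exprn_ege1.
rewrite hd dnormB /= ee tz dq (geC0_conj q0) opprD addrA addrK lerDl oppr_ge0 => q0'.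
have /eqP : q = 0 by apply/eqP; rewrite eq_le q0 q0'.
rewrite /q mulf_eq0 invr_eq0 (gt_eqF zz) orbF sqrf_eq0 normr_eq0 => /eqP.
by [].
Qed.

Variables (U Us : blin X X).

(** The operator [A |-> L o A o U]. The derivative of [L o F o U] is [conj_op L o F' o U], of the
    same shape again, so the rule iterates. *)
Definition conj_op (Y Z : normedModType R[i]) (L : blin Y Z) :
    blin (blin X Y) (blin X Z) :=
  bil_appr (@bcomp_bbilin _ X Y Z) L
    (bil_appl (@bcomp_bbilin _ X X Y) (blin_id (blin X Y)) U).

Lemma hasD_conj (Y Z : normedModType R[i]) (L : blin Y Z) (F : X -> Y) x :
  differentiable F (U x) ->
  hasD (fun y => L (F (U y))) x (conj_op L (frechet F (U x))).
Proof.
move=> /diff_hasD DF.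
exact: (hasD_comp (hasD_blin L (F (U x))) (hasD_comp DF (hasD_blin U x))).
Qed.

Lemma conj_germ (f : X -> X) (r : R) : 0 < r -> smooth 3 [set x | nrm x < r] f ->
  let g := fun x => Us (f (U x)) in
  (forall h k, D2at0 g h k = Us (D2at0 f (U h) (U k))) /\
  (forall h k l, D3at0 g h k l = Us (D3at0 f (U h) (U k) (U l))).
Proof.
move=> r0 [df [dff [dfff _]]] g.
have U1 : 0 < nrm U + 1 by rewrite ltr_wpDl ?nrm_ge0.
pose D := [set x : X | nrm x < r / (nrm U + 1)].
have UD x : D x -> nrm (U x) < r.
  rewrite /D /= ltr_pdivlMr// => xr; rewrite (le_lt_trans _ xr)//.
  by rewrite (le_trans (blin_nrm _ _))// mulrC ler_wpM2l ?nrm_ge0// lerDl.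
have near_D x : D x -> \forall y \near x, D y.
  by move=> Dx; apply: open_nbhs_nbhs; split => //; exact: nrm_ball_open.
have D0 : D 0 by rewrite /D /= nrm0 divr_gt0.
have g1 x : D x -> frechet g x = conj_op Us (frechet f (U x)).
  by move=> /UD/df/(hasD_conj Us)/hasD_frechet.
have g2 x : D x -> frechet (frechet g) x =
    conj_op (conj_op Us) (frechet (frechet f) (U x)).
  move=> Dx; apply: hasD_frechet.
  apply: hasD_eq (hasD_conj (conj_op Us) (dff _ (UD _ Dx))).
  by apply: filterS (near_D _ Dx) => y /g1.
have g3 : frechet (frechet (frechet g)) 0 =
    conj_op (conj_op (conj_op Us)) (frechet (frechet (frechet f)) (U 0)).
  apply: hasD_frechet.
  apply: hasD_eq (hasD_conj (conj_op (conj_op Us)) (dfff _ (UD _ D0))).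
  by apply: filterS (near_D _ D0) => y /g2.
rewrite linear0 in g3; split=> [h k|h k l].
  by have := g2 0 D0; rewrite linear0 /D2at0 => H; rewrite /= H.
by rewrite /D3at0 /= g3.
Qed.

End UnitaryInvariance.

(** * The Fekete-Szego mapping *)

Section Iterates.
Context (R : realType) (X : completeNormedModType R[i]).

(** Composing with [f] on the left adds [3 n D^2 f[e, D^2 f[e,e]]] at step [n], and
    [3 (0 + ... + (n-1)) = 3 n (n-1) / 2]. In this order the outer second derivative is that of [f],
    which is symmetric. *)
Lemma iterate_germ (f : X -> X) n : normalized_holomorphic f ->
  [/\ tangent_germ (iter n f),
      forall h k, D2at0 (iter n f) h k = n%:R *: D2at0 f h k &
      forall e, D3at0 (iter n f) e e e = n%:R *: D3at0 f e e e +
        (3 * n%:R * (n%:R - 1) / 2) *: D2at0 f e (D2at0 f e e)].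
Proof.
move=> hf; have gf := normalized_germ hf.
elim: n => [|n [gn n2 n3]].
  have -> : iter 0 f = fun x => x by [].
  split=> [|h k|e]; first exact: tangent_germ_id.
    by rewrite D2at0_id scale0r.
  by rewrite D3at0_id mulr0 !mul0r !scale0r addr0.
have [gn1 c2 c3] := germ_comp gf gn.
have -> : iter n.+1 f = f \o iter n f by [].
split=> // [h k|e]; first by rewrite c2 n2 -natr1 scalerDl scale1r addrC.
rewrite c3 n2 n3 (normalized_sym hf _ e).
have -> : D2at0 f e (n%:R *: D2at0 f e e) = n%:R *: D2at0 f e (D2at0 f e e).
  exact: linearZ.
set u := D3at0 f e e e; set v := D2at0 f e (D2at0 f e e).
rewrite -{1}[u]scale1r addrA -scalerDl -addrA scalerA -scalerDl -addrA -scalerDl.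
by congr (_ *: _ + _ *: _); rewrite -natr1; [ring|field].
Qed.

End Iterates.

Theorem theorem1p1 (R : realType) (X : completeNormedModType R[i])
    (lam mu : R[i]) (e : X) (es : dual X) (f : X -> X)
    (he : `|e| = 1) (hes : duality_map e es) (hf : normalized_holomorphic f) :
  [/\ (* (i) *)
      forall n : nat, (0 < n)%N ->
        (forall (nu : R[i]) (g : X -> X),
           homog f 2 e = nu *: e ->
           normalized_holomorphic g -> root_transform n e es f g ->
           forall mu' : R[i],
             homog g (2 * n + 1) e =
               n%:R^-1 *: Psi e es f (n.-1%:R / (2 * n%:R)) mu')
        /\
        (forall s r : X -> R[i]^o,
           holomorphic_on (unit_ball X) s ->
           (forall x, unit_ball X x -> f x = s x *: x) ->
           univalent f ->
           root_branch n s r ->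
           let g := fun x : X => r ((es x : R[i]) ^+ n *: e) *: x in
           one_dim_type g /\ univalent g),
      (* (ii) *)
      forall (dot : {dot X for Num.conj}), hilbert_dot dot ->
        forall (U Us : blin X X), unitary dot U Us ->
        forall ets : dual X, duality_map (U e) ets ->
          Psi e es (fun x => Us (f (U x))) lam mu = Us (Psi (U e) ets f lam mu),
      (* (iii) *)
      forall g : X -> X, normalized_holomorphic g ->
        D2at0 f = 0 \/ D2at0 g = 0 ->
        Psi e es (f \o g) lam mu = Psi e es f lam mu + Psi e es g lam mu,
      (* (iv) *)
      forall h : X -> X, local_inverse f h ->
        Psi e es h lam mu = - Psi e es f (2 - lam) (2 - mu) &
      (* (v) *)
      forall n : nat, (0 < n)%N ->
        Psi e es (iter n f) lam mu =
          n%:R *: Psi e es f (n%:R * lam - n%:R + 1) (n%:R * mu - n%:R + 1)].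
Proof.
have [e1 es1 nes] := dualityP he hes.
split.
- move=> n n0; split=> [nu g P2 hg hroot mu'|s r hs fs uf hr]; last first.
    exact: (root_transform_one_dim e1 nes n0 fs uf hr).
  rewrite (root_transform_coef e1 es1 n0 hf hg P2 hroot) /Psi P2.
  (* Both correction terms of [Psi] become multiples of [nu^2 e] and [mu'] cancels; what remains is
     [- (n-1)/(2n) nu^2], that is [n] times [gbinom (1/n) 2 * nu^2]. *)
  have -> : D2at0 f e (nu *: e) = (2 * nu ^+ 2) *: e.
    have D2e : D2at0 f e e = 2 *: (nu *: e).
      by rewrite -P2 /homog scalerA divff ?scale1r// pnatr_eq0.
    have -> : D2at0 f e (nu *: e) = nu *: D2at0 f e e by exact: linearZ.
    by rewrite D2e !scalerA; congr (_ *: _); ring.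
  have -> : es (nu *: e) = nu.
    have -> : es (nu *: e) = nu * (es e : R[i]) by exact: linearZ.
    by rewrite es1 mulr1.
  have n1 : n%:R != 0 :> R[i] by rewrite pnatr_eq0 -lt0n.
  have -> : n.-1%:R = n%:R - 1 :> R[i] by rewrite -subn1 natrB.
  rewrite !scalerA -addrA scalerDr -opprD scalerN -scalerDl scalerA.
  rewrite -scaleNr scalerA; congr (_ + _ *: _).
  rewrite /gbinom !big_ord_recr big_ord0 /= mul1r subr0.
  have -> : 2`! = 2%N by [].
  by field.
- move=> dot hd U Us [adj UsU UUs] ets hets.
  have [rf rf0 sf] := normalized_smooth hf 3.
  have [g2 g3] := conj_germ U Us rf0 sf.
  have UUsE x : U (Us x) = x.
    by have := congr1 (fun T : blin X X => T x) UUs.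
  have UsUE x : Us (U x) = x.
    by have := congr1 (fun T : blin X X => T x) UsU.
  have nUe : `|U e| = 1.
    apply/eqP; rewrite -(@pexpr_eq1 _ _ 2)// hd adj UsUE -hd he expr1n.
    by [].
  (* Both functionals are inner products, with [e] and with [U e], so this is the adjoint
     relation. *)
  have esUs y : es (Us y) = ets y.
    rewrite (duality_dot _ hd he hes) (duality_dot _ hd nUe hets).
    by rewrite hermC /= -adj [RHS]hermC.
  rewrite !PsiE g2 g3 g2 UUsE esUs.
  by rewrite !linearB !linearZ.
- move=> g hg D20.
  have [_ c2 c3] := germ_comp (normalized_germ hf) (normalized_germ hg).
  rewrite !PsiE !c3 !c2.
  set u := D3at0 f e e e; set v := D3at0 g e e e.
  (* Every mixed term, in the third derivative and in [Psi], contains a second derivative of [f] and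
     one of [g], and so vanishes in either case. *)
  case: D20 => D20; rewrite D20 !blin0E ?linear0 ?scaler0 ?add0r ?addr0.
    by rewrite scalerDr -!addrA.
  by rewrite scalerDr -!addrA; congr (_ + _); rewrite addrC -addrA.
- move=> h hh; have [h2 h3] := inverse_derivatives hf hh e.
  rewrite !PsiE h3 !h2; set w := D2at0 f e e.
  have -> : es (- w) = - (es w : R[i]) by exact: linearN.
  have -> : D2at0 f e (- w) = - D2at0 f e w by exact: linearN.
  move: (D3at0 f e e e) (D2at0 f e w) (es w : R[i]) => u v a.
  (* The third derivative of [h] contributes [3/6] to the coefficient of [v], and
     [1/2 - mu/4 = (2 - mu)/4]; in the coefficient of [w], [lam - mu = - ((2 - lam) - (2 - mu))]. *)
  rewrite opprK scalerDr !scalerN mulrN scaleNr opprK scalerA -addrA.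
  rewrite !opprD !opprK [LHS]addrA -(scaleNr _ v) -(scaleNr _ w) -[X in X + _ = _]addrA -scalerDl.
  by congr (_ + _ *: _ + _ *: _); field.
- move=> n n0; have [_ n2 n3] := iterate_germ n hf.
  rewrite !PsiE n3 !n2; set w := D2at0 f e e.
  have -> : es (n%:R *: w) = n%:R * (es w : R[i]) by exact: linearZ.
  have -> : D2at0 f e (n%:R *: w) = n%:R *: D2at0 f e w by exact: linearZ.
  move: (D3at0 f e e e) (D2at0 f e w) (es w : R[i]) => u v a.
  (* The coefficient of [v] is [n (n-1)/4 - mu n^2/4 = - n (n mu - n + 1)/4]; in that of [w] the
     shifts [- n + 1] cancel. *)
  rewrite scalerDr !scalerBr !scalerA -[X in X - _ = _]addrA -scalerBl.
  by rewrite -(scaleNr _ v); congr (_ *: _ + _ *: _ - _ *: _); field.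
Qed.
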